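(* Let $q$ be a power of a prime $p$, and pick any $a,b,c,d\in\mathbb{F}_{q^2}$. Then $f(X) := aX^{3q} + bX^{2q+1} + cX^{q+2} + d X^3$ is a complete mapping of $\mathbb{F}_{q^2}$ if and only if one of the following holds: (1) $f(X)$ is $\mathbb{F}_q$-linearly conjugate to $\gamma X^{q+2}$ for some $\gamma\in\mathbb{F}_{q^2}^*$ with $\gamma^{2q-2}-\gamma^{q-1}+1=0$; (2) $q\equiv 0\pmod 3$ and $f(X)=aX^{3q}+dX^3$ where $a^{q+1}\ne d^{q+1}$ and $aX^{3q-1}+dX^2+1$ has no roots in $\mathbb{F}_{q^2}^*$.
   Context: A complete mapping of a field $F$ is a permutation $\pi$ of $F$ such that $x\mapsto \pi(x)+x$ also permutes $F$; a polynomial is called a complete mapping if the function it induces is one. Polynomials $f,g\in\mathbb{F}_{q^2}[X]$ are $\mathbb{F}_q$-linearly conjugate if the induced functions on $\mathbb{F}_{q^2}$ satisfy $f=\rho^{-1}\circ g\circ\rho$ for some $\mathbb{F}_q$-vector space automorphism $\rho$ of $\mathbb{F}_{q^2}$; equivalently, there exist $a,b\in\mathbb{F}_{q^2}$ with $a^{q+1}\ne b^{q+1}$ such that, with $L(X):=aX^q+bX$ and $L^{-1}(X):=(aX^q-b^qX)/(a^{q+1}-b^{q+1})$, one has $f(X)\equiv L^{-1}(X)\circ g(X)\circ L(X)\pmod{X^{q^2}-X}$. *)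

(* Defs.v *)
From HB Require Import structures.
From mathcomp Require Import all_boot all_order all_algebra all_field.
Set Implicit Arguments. Unset Strict Implicit. Unset Printing Implicit Defensive.
Import GRing.Theory.
Local Open Scope ring_scope.

Definition complete_mapping (F : finFieldType) (pi : F -> F) : Prop :=
  bijective pi /\ bijective (fun x => pi x + x).

(* rho : F -> F is F_q-linear, where F_q = {c in F | c^q = c} is the subfield
   of order q of F = F_{q^2}. *)
Definition Fq_linear (F : finFieldType) (q : nat) (rho : F -> F) : Prop :=
  (forall x y, rho (x + y) = rho x + rho y) /\
  (forall c x, c ^+ q = c -> rho (c * x) = c * rho x).

Definition Fq_lin_conj (F : finFieldType) (q : nat) (f g : F -> F) : Prop :=
  exists (rho rhoinv : F -> F),
    [/\ cancel rho rhoinv, cancel rhoinv rho, Fq_linear q rho &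
        forall x, f x = rhoinv (g (rho x))].

Definition fabcd (F : finFieldType) (q : nat) (a b c d : F) : F -> F :=
  fun x => a * x ^+ (3 * q) + b * x ^+ (2 * q + 1) + c * x ^+ (q + 2)
           + d * x ^+ 3.

(* Main.v *)
Require Import Defs.
From HB Require Import structures.
From mathcomp Require Import all_boot all_order all_algebra all_fingroup all_solvable.
From mathcomp Require Import all_field.
From mathcomp Require Import ring zify.
Set Implicit Arguments. Unset Strict Implicit. Unset Printing Implicit Defensive.
Import GRing.Theory.
Local Open Scope ring_scope.

(* Write [K] for the fixed field of the involution [phi : x |-> x^q]; then [F]
   is a plane over [K] and [f] becomes a pair of binary cubic forms. Since [f (l
   x) = l^3 f x] for [l] in [K], injectivity of [f + id] is equivalent to
   injectivity of [f + z^2 id] for all nonzero [z] in [K]. Writing this out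
   along a line of direction [e] says that, up to a constant, some polynomial
   over [K] of degree at most 4 takes only square values. A polynomial [H] with
   square values satisfies [H^((q+1)/2) = H] on [K]; comparing derivatives of
   [H^((q+1)/2) = H + (X^q - X) T] gives a differential equation which, unless
   [q] is very small, forces [H] to be the square of a polynomial. Letting [e]
   vary, the resulting discriminant, a binary quartic in [e], vanishes
   identically, and this determines [f] up to a [K]-linear change of basis. In
   characteristic 3 the polarisation of [f] is governed by a linear map [L]; it
   is either zero, which is case (2), or scalar, which gives case (1). The
   fields [K] of order 2, 3 and 5 are checked by hand or by enumeration.
   Conversely, for [g = gamma x^(q+2)] the norm of [g x + x] is a cubic
   polynomial in the norm of [x], and the difference of two of its values splits
   into factors that are exchanged by [phi]. *)

(** Proof pattern used throughout: [e] is a combination of expressions known to vanish, and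
    [x - y = e] is left to [ring] or [field]. *)
Lemma lincomb (R : zmodType) (e x y : R) : e = 0 -> x - y = e -> x = y.
Proof. by move=> -> /eqP; rewrite subr_eq0 => /eqP. Qed.

(** * Squares and quadratic equations over a finite field *)

Section FiniteField.
Variable K : finFieldType.

Lemma poly_vanish (P : {poly K}) :
  (size P <= #|K|)%N -> (forall x, P.[x] = 0) -> P = 0.
Proof.
move=> sP P0; apply/eqP; apply: contraT => nzP.
have := max_poly_roots nzP (rs := enum K).
rewrite enum_uniq -cardE => /(_ _ isT).
rewrite ltnNge sP; apply; apply/allP => x _; exact/eqP/P0.
Qed.

Lemma coefs_vanish (s : seq K) :
  (size s <= #|K|)%N -> (forall x, (Poly s).[x] = 0) -> forall i, s`_i = 0.
Proof.
move=> ss s0 i; rewrite -coef_Poly.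
by rewrite (poly_vanish (leq_trans (size_Poly s) ss) s0) coef0.
Qed.

(** [g] generates the cyclic unit group; the parity of the exponent of [x] decides its class. *)
Lemma square_class :
  exists g : K, forall x, exists y, x = y ^+ 2 \/ x = g * y ^+ 2.
Proof.
have /cyclicP[g gE] := field_unit_group_cyclic [set: {unit K}].
exists (val g) => x; have [->|nzx] := eqVneq x 0.
  by exists 0; left; rewrite expr0n.
have ux : x \is a GRing.unit by rewrite unitfE.
have: FinRing.unit K ux \in <[g]>%g by rewrite -gE inE.
case/cycleP => i /(congr1 val) /=; rewrite FinRing.val_unitX => ->.
exists (val g ^+ i./2); rewrite -exprM muln2 -exprS.
by have := odd_double_half i; case: (odd i) => /= iE; [right|left]; rewrite -{1}iE.
Qed.

Lemma square_or (x y : K) :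
  y != 0 -> (exists s, x = s ^+ 2) \/ (exists s, y = s ^+ 2) \/
  (exists s, x / y = s ^+ 2).
Proof.
move=> nzy; have [g gP] := square_class.
have [s [->|xE]] := gP x; first by left; exists s.
have [t [->|yE]] := gP y; first by right; left; exists t.
right; right; exists (s / t).
move: nzy; rewrite xE yE mulf_eq0 negb_or sqrf_eq0 => /andP[nzg nzt].
by field; rewrite nzg nzt.
Qed.

Lemma expf_card_half (s : K) m : #|K| = m.*2.+1 -> s != 0 -> (s ^+ 2) ^+ m = 1.
Proof.
move=> cK nzs; have := expf_card s; rewrite cK exprS -[RHS]mulr1.
by rewrite -exprM mul2n => /(mulfI nzs).
Qed.

Lemma card_odd : (2%:R : K) != 0 -> exists m, #|K| = m.*2.+1.
Proof.
move=> n2; exists (#|K|./2).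
case oK : (odd #|K|); first by rewrite -{1}(odd_double_half #|K|) oK.
have cK : #|K| = (#|K|./2 * 2)%N by rewrite muln2 -{1}(odd_double_half #|K|) oK.
have := expf_card (-1 : K); rewrite cK mulnC exprM sqrrN !expr1n => h.
by case/eqP: n2; rewrite mulr2n [X in X + _]h addNr.
Qed.

(** Without a solution, [(c - b * y ^+ 2) / a] would always be [g] times a nonzero square, so its
    power of exponent [m], with [#|K| = 2 m + 1], would be constant on [K]. That power has degree
    [#|K| - 1] in [y], too small for this. *)
Lemma quadric_solvable (a b c : K) : (2%:R : K) != 0 -> a != 0 -> b != 0 ->
  exists x y, a * x ^+ 2 + b * y ^+ 2 = c.
Proof.
move=> n2 nza nzb; have [m cK] := card_odd n2.
have [g gP] := square_class.
case: (boolP [exists x, exists y, a * x ^+ 2 + b * y ^+ 2 == c]).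
  by case/existsP => x /existsP[y /eqP h]; exists x, y.
rewrite negb_exists => /forallP no.
pose Q : {poly K} := (c / a)%:P - (b / a) *: 'X^2.
have vQ y : Q.[y] ^+ m = g ^+ m.
  have -> : Q.[y] = (c - b * y ^+ 2) / a
    by rewrite /Q hornerD hornerN hornerC hornerZ hornerXn; field.
  have [s [sE|sE]] := gP ((c - b * y ^+ 2) / a).
    have := no s; rewrite negb_exists => /forallP/(_ y)/eqP[].
    by rewrite -sE; field.
  rewrite sE exprMn (expf_card_half cK) ?mulr1 //.
  apply: contraTneq (no 0) => s0; rewrite negbK; apply/existsP; exists y.
  apply/eqP; move/(congr1 (fun z => z * a)): sE.
  rewrite s0 divfK // => h; apply: (lincomb (e := - (c - b * y ^+ 2))).
    by rewrite h; ring.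
  by ring.
have sQ : size Q = 3.
  rewrite /Q addrC size_polyDl ?size_polyN size_scale ?size_polyXn //;
    rewrite ?mulf_neq0 ?invr_eq0 //.
  exact: leq_ltn_trans (size_polyC_leq1 _) _.
have m0 : (0 < m)%N.
  by have := finNzRing_gt1 K; rewrite cK; case: (m).
have: Q ^+ m - (g ^+ m)%:P = 0.
  apply: poly_vanish => [|y]; last by rewrite hornerD hornerN hornerC horner_exp vQ subrr.
  rewrite (leq_trans (size_polyD _ _)) // geq_max size_polyN.
  rewrite (leq_trans (size_poly_exp_leq _ _)) ?sQ ?cK ?mul2n //.
  by rewrite (leq_trans (size_polyC_leq1 _)).
move/eqP; rewrite subr_eq0 => /eqP h; have := size_exp Q m.
by rewrite h sQ size_polyC; case: (_ != 0); case: (m) m0.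
Qed.

End FiniteField.
(** * Polynomials with square values *)

Section SquareValued.
Variable K : finFieldType.
Hypothesis n2 : (2%:R : K) != 0.
Local Notation W := ('X^#|K| - 'X : {poly K}).

Lemma natr_card : (#|K|%:R : K) = 0.
Proof.
have : \sum_(x : K) (x + 1) = \sum_(x : K) x.
  by rewrite [RHS](reindex_inj (addIr (1 : K))).
by rewrite big_split /= sumr_const -[RHS]addr0 => /addrI.
Qed.

Lemma size_W : size W = #|K|.+1.
Proof.
rewrite size_polyDl ?size_polyXn // size_polyN size_polyX ltnS.
exact: finNzRing_gt1.
Qed.

Lemma deriv_W : W^`() = -1.
Proof. by rewrite derivB derivXn derivX -scaler_nat natr_card scale0r sub0r. Qed.

(** With [#|K| = 2 m + 1], [H ^+ m.+1] agrees with [H] on [K], hence equals [H + W * T]. As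
    [2 (m + 1) = 1] in [K] and the derivative of [W] is [-1], differentiation gives the first
    equation with [E = 2 H T' - H' T]. Differentiating again and eliminating [T] gives the second,
    in [H] and [E] only. *)
Lemma square_valued_ode (H : {poly K}) d :
  (1 < d)%N -> (size H <= d.+1)%N -> (forall x, exists s, H.[x] = s ^+ 2) ->
  exists T E : {poly K},
  [/\ W * E = H * (2%:R * T - H^`()),
      W * (2%:R * H * E^`() - 3%:R * H^`() * E) =
        4%:R * H * E + H * H^`() ^+ 2 - 2%:R * H ^+ 2 * H^`()^`() &
      E != 0 -> (2 * size E + 4 * #|K| <= 2 * d + d * #|K|.+1 + 2)%N].
Proof.
move=> d1 sH sqH; have [m cK] := card_odd n2.
pose U := H ^+ m.+1.
have UH x : (U - H).[x] = 0.
  rewrite hornerD hornerN horner_exp; have [s ->] := sqH x.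
  have [->|nzs] := eqVneq s 0; first by rewrite expr0n /= expr0n subrr.
  by rewrite exprS (expf_card_half cK) // mulr1 subrr.
have nzW : W != 0 by rewrite -size_poly_eq0 size_W.
have r0 : (U - H) %% W = 0.
  apply: poly_vanish => [|x].
    by rewrite -ltnS -size_W ltn_modp.
  have := divp_eq (U - H) W => /(congr1 (fun P : {poly K} => P.[x])).
  rewrite UH hornerD hornerM.
  by rewrite [W.[x]]hornerD hornerN hornerXn hornerX expf_card subrr mulr0 add0r.
pose T := (U - H) %/ W.
have UE : U = H + W * T.
  by have := divp_eq (U - H) W; rewrite r0 addr0 mulrC => /eqP; rewrite subr_eq addrC => /eqP.
have [E EE] : exists E, E = 2%:R * H * T^`() - H^`() * T by eexists.
have ode0 : 2%:R * H * U^`() = H^`() * U.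
  rewrite /U deriv_exp /= -mulr_natl exprS.
  have e : (2%:R * m.+1%:R : {poly K}) = 1.
    rewrite -natrM -[RHS](rmorph_nat (polyC : {rmorphism K -> {poly K}}) 1).
    rewrite -(rmorph_nat (polyC : {rmorphism K -> {poly K}})); congr polyC.
    have -> : (2 * m.+1 = #|K| + 1)%N by rewrite cK; lia.
    by rewrite natrD natr_card add0r.
  transitivity (2%:R * m.+1%:R * (H^`() * (H * H ^+ m))); last by rewrite e mul1r.
  by ring.
have ode1 : W * E = H * (2%:R * T - H^`()).
  move: ode0; rewrite UE derivD derivM deriv_W => h.
  apply: (lincomb (e := 2%:R * H * (H^`() + (-1 * T + W * T^`())) - H^`() * (H + W * T))).
    by rewrite h subrr.
  by rewrite EE; ring.
exists T, E; split => //.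
  have h := congr1 (fun P => P^`()) ode1.
  have d2 : (2%:R : {poly K})^`() = 0 by rewrite derivMn -polyC1 derivC mul0rn.
  move: h; rewrite !derivM deriv_W derivB derivM d2 mul0r add0r => h.
  set W' := W in ode1 h *.
  pose e1 := W' * E - H * (2%:R * T - H^`()).
  pose e2 := -1 * E + W' * E^`() - (H^`() * (2%:R * T - H^`()) + H * (2%:R * T^`()
    - H^`()^`())).
  apply: (lincomb (e := 2%:R * H * e2 - 3%:R * H^`() * e1)).
    by rewrite /e1 /e2 ode1 h !subrr !mulr0 subrr.
  by rewrite /e1 /e2 EE; ring.
(* Degree count: the size of [W * T] bounds that of [T], and the first equation then bounds that of
   [E]. *)
move=> nzE.
have sWT : (size (W * T)%R <= d * m.+1 + 1)%N.
  have -> : W * T = U - H by rewrite UE [H + _]addrC addrK.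
  rewrite (leq_trans (size_polyD _ _)) // geq_max size_polyN.
  rewrite (leq_trans (size_poly_exp_leq _ _)) ?(leq_trans sH) //; first last.
    by rewrite addn1 ltnS leq_mul2r; apply/orP; right; lia.
  by nia.
have sT : (size T + #|K| <= d * m.+1 + 1)%N.
  have [T0|nzT] := eqVneq T 0; first by rewrite T0 size_poly0 cK; nia.
  by move: sWT; rewrite size_mul // size_W addSn /= addnC.
have sTH : (size (2%:R * T - H^`())%R + #|K| <= d * m.+1 + 1)%N.
  have s1 : (size (2%:R * T)%R <= size T)%N by rewrite mulr_natl -scaler_nat size_scale_leq.
  have s2 : (size H^`() <= d)%N.
    have [->|nzH] := eqVneq H 0; first by rewrite deriv0 size_poly0.
    by have := lt_size_deriv nzH; lia.
  have := size_polyD (2%:R * T) (- H^`()); rewrite size_polyN => s3.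
  have s4 : (d + #|K| <= d * m.+1 + 1)%N by rewrite cK; nia.
  apply: leq_trans (_ : maxn (size T) d + #|K| <= _)%N.
    rewrite leq_add2r (leq_trans s3) // geq_max !leq_max.
    by rewrite s1 s2 orbT.
  by rewrite addn_maxl geq_max sT s4.
have nzr : H * (2%:R * T - H^`()) != 0 by rewrite -ode1 mulf_neq0.
have := congr1 (fun P : {poly K} => size P) ode1.
move: nzr; rewrite mulf_eq0 negb_or => /andP[nzH nzt].
rewrite !size_mul // size_W addSn /= => h.
move: nzE h sH sTH; rewrite -size_poly_gt0 cK.
move: (size E) (size H) (size (2%:R * T - H^`() : {poly K})) => x y z; lia.
Qed.
End SquareValued.

(** * Quartics and cubics with square values *)

Section SquareValuedQuartic.
Variable K : finFieldType.
Hypothesis n2 : (2%:R : K) != 0.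
Local Notation W := ('X^#|K| - 'X : {poly K}).

Lemma mulW_small (Z P : {poly K}) :
  W * Z = P -> (size P <= #|K|)%N -> Z = 0 /\ P = 0.
Proof.
move=> <- sP; have [->|nzZ] := eqVneq Z 0; first by rewrite mulr0.
have nzW : W != 0 by rewrite -size_poly_eq0 size_W.
move: sP; rewrite size_mul // size_W addSn /=.
by rewrite -{2}[#|K|]addn0 leq_add2l leqn0 size_poly_eq0 (negPf nzZ).
Qed.

Lemma size_cubic_leq (a b c d : K) :
  (size (a%:P * 'X^3 + b%:P * 'X^2 + c%:P * 'X + d%:P)%R <= 4)%N.
Proof.
have -> : a%:P * 'X^3 + b%:P * 'X^2 + c%:P * 'X + d%:P
  = Poly [:: d; c; b; a].
  by rewrite /= !cons_poly_def; ring.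
exact: size_Poly.
Qed.

Lemma size_quartic (a b c d : K) :
  size ('X^4 + a%:P * 'X^3 + b%:P * 'X^2 + c%:P * 'X + d%:P)%R = 5%N.
Proof.
rewrite -!addrA size_polyDl size_polyXn // ltnS !addrA.
exact: size_cubic_leq.
Qed.

(** For [d = 4] the terms in [#|K|] cancel in the degree bound, so [E] has size at most 7 over every
    field. *)
Lemma ode_bound_quartic (H E : {poly K}) :
  (size H <= 5)%N -> (size H^`() <= 4)%N -> (size H^`()^`() <= 3)%N ->
  (E != 0 -> (2 * size E + 4 * #|K| <= 2 * 4 + 4 * #|K|.+1 + 2)%N) ->
  (size (4%:R * E + H^`() ^+ 2 - 2%:R * H * H^`()^`())%R <= 7)%N.
Proof.
move=> s0 s1 s2 sE.
have s3 : (size E <= 7)%N.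
  have [->|/sE] := eqVneq E 0; first by rewrite size_poly0.
  by move: (size E); lia.
have s4 (n : nat) (P : {poly K}) : (size (n%:R * P)%R <= size P)%N.
  by rewrite mulr_natl -scaler_nat size_scale_leq.
rewrite (leq_trans (size_polyD _ _)) // geq_max size_polyN; apply/andP; split.
  rewrite (leq_trans (size_polyD _ _)) // geq_max (leq_trans (s4 _ _)) //=.
  rewrite (leq_trans (size_polyMleq _ _)) // -ltnS.
  by move: s1; move: (size _) => x; lia.
rewrite -mulrA (leq_trans (s4 _ _)) // (leq_trans (size_polyMleq _ _)) //.
by move: s0 s2; move: (size _) (size _) => x y; lia.
Qed.

(** The right side of the second equation is a multiple of [W] of size at most 11, hence zero. So
    [2 H E' = 3 H' E] and [4 E = 2 H H'' - H' ^ 2], and eliminating [E] leaves an identity in [H]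
    alone. *)
Lemma quartic_square_valued (h2 h0 : K) : (3%:R : K) != 0 -> (10 < #|K|)%N ->
  (forall x, exists s, x ^+ 4 + h2 * x ^+ 2 + h0 = s ^+ 2) ->
  h2 ^+ 2 = 4%:R * h0.
Proof.
move=> n3 hq sq.
have [H HE] : exists H : {poly K},
    H = 'X^4 + 0%:P * 'X^3 + h2%:P * 'X^2 + 0%:P * 'X + h0%:P by eexists.
have hH x : H.[x] = x ^+ 4 + h2 * x ^+ 2 + h0.
  by rewrite HE !(hornerD, hornerCM, hornerXn, hornerX, hornerC); ring.
have H1 : H^`() = 4%:R%:P * 'X^3 + 0%:P * 'X^2 + (2%:R * h2)%:P * 'X + 0%:P.
  by rewrite HE !derivE /= !(polyCM, polyC_natr, polyC0); ring.
have H2 : H^`()^`() = 12%:R%:P * 'X^2 + (2%:R * h2)%:P.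
  by rewrite H1 !derivE /= !(polyCM, polyC_natr, polyC0); ring.
have H3 : H^`()^`()^`() = 24%:R%:P * 'X.
  by rewrite H2 !derivE /= !(polyCM, polyC_natr, polyC0); ring.
have sH : size H = 5 by rewrite HE size_quartic.
have nzH : H != 0 by rewrite -size_poly_eq0 sH.
have s1 : (size H^`() <= 4)%N by rewrite H1 size_cubic_leq.
have s2 : (size H^`()^`() <= 3)%N.
  have [->|nz] := eqVneq H^`() 0; first by rewrite deriv0 size_poly0.
  by have := lt_size_deriv nz; move: s1; move: (size _) (size _) => x y; lia.
have sqH x : exists s, H.[x] = s ^+ 2 by rewrite hH.
have [T [E [_ ode2 sE]]] := square_valued_ode n2 (isT : (1 < 4)%N) (eq_leq sH) sqH.
have sR := ode_bound_quartic (eq_leq sH) s1 s2 sE.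
have RE : 4%:R * H * E + H * H^`() ^+ 2 - 2%:R * H ^+ 2 * H^`()^`() =
  H * (4%:R * E + H^`() ^+ 2 - 2%:R * H * H^`()^`()) by ring.
rewrite RE in ode2.
have [] := mulW_small ode2.
  rewrite (leq_trans (size_polyMleq _ _)) // sH.
  by move: sR; move: (size _) => x; lia.
move=> Z0 /eqP; rewrite mulf_eq0 (negPf nzH) /= => /eqP E0.
have E1 : 4%:R%:P * E = 2%:R%:P * (H * H^`()^`()) - H^`() * H^`().
  by apply: (lincomb E0); rewrite !polyC_natr; ring.
have := congr1 (fun P => P^`()) E1.
rewrite !(deriv_mulC, derivB, derivM) => E2.
have id x : 24%:R * x * H.[x] ^+ 2 * 4%:R =
   3%:R * H^`().[x] * (2%:R * H.[x] * H^`()^`().[x] - H^`().[x] ^+ 2).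
  have e1 := congr1 (fun P : {poly K} => P.[x]) E1.
  have e2 := congr1 (fun P : {poly K} => P.[x]) E2.
  have e3 := congr1 (fun P : {poly K} => P.[x]) Z0.
  have e4 := congr1 (fun P : {poly K} => P.[x]) H3.
  move: e1 e2 e3 e4; rewrite -!polyC_natr.
  rewrite !(hornerCM, hornerD, hornerN, hornerM, hornerX, horner0, hornerC).
  move: H.[x] H^`().[x] (H^`()^`()).[x] (H^`()^`()^`()).[x] E.[x] E^`().[x].
  move=> a a1 a2 a3 e e' e1 e2 e3 e4; rewrite e4 in e2.
  pose d1 := 4 * e - (2 * (a * a2) - a1 * a1).
  pose d2 := 4 * e' - (2 * (a1 * a2 + a * (24 * x)) - (a2 * a1 + a1 * a2)).
  apply: (lincomb (e := - 2%:R * a * d2 + 3%:R * a1 * d1 + 4%:R * (2 * a * e' - 3 * a1 * e))).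
    have -> : d1 = 0 by rewrite /d1 e1; ring.
    have -> : d2 = 0 by rewrite /d2 e2; ring.
    have -> : 2 * a * e' - 3 * a1 * e = 0 by exact: e3.
    by rewrite !mulr0 !addr0.
  by rewrite /d1 /d2; ring.
(* Coefficients, constant term first, of the difference of the two sides of [id]; the one of degree
   5 is [24 (h2 ^ 2 - 4 h0)]. *)
pose y2 := 24%:R * h2 ^+ 2 - 96%:R * h0.
pose s := [:: 0; 96%:R * h0 ^+ 2 - 24%:R * h0 * h2 ^+ 2 ; 0; 0; 0; y2 : K].
have y20 : y2 = 0.
  apply: (coefs_vanish (s := s) _ _ 5); first by apply: leq_trans hq.
  move=> x; rewrite horner_Poly /=.
  have := id x; rewrite hH H2 H1 !(hornerD, hornerCM, hornerXn, hornerX, hornerC) => idx.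
  move/eqP: idx; rewrite -subr_eq0 => /eqP idx.
  by apply: (lincomb idx); rewrite /y2; ring.
have n24 : (24%:R : K) != 0 by rewrite (natrM _ 8 3) mulf_neq0 // (natrX _ 2 3) expf_neq0.
apply: (mulfI n24); apply: (lincomb y20); rewrite /y2; ring.
Qed.

Section CharThree.
Hypothesis c3 : (3%:R : K) = 0.

(** The term [3 H' E] disappears and every remaining term has a factor [H], which cancels. *)
Lemma ode_char3 (H E : {poly K}) : H != 0 ->
  W * (2%:R * H * E^`() - 3%:R * H^`() * E) =
    4%:R * H * E + H * H^`() ^+ 2 - 2%:R * H ^+ 2 * H^`()^`() ->
  W * (2%:R * E^`()) = 4%:R * E + H^`() ^+ 2 - 2%:R * H * H^`()^`().
Proof.
move=> nzH; have -> : 3%:R = 0 :> {poly K} by rewrite -polyC_natr c3.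
move=> h; apply: (mulfI nzH).
have e : H * (4%:R * E + H^`() ^+ 2 - 2%:R * H * H^`()^`())
  = 4%:R * H * E + H * H^`() ^+ 2 - 2%:R * H ^+ 2 * H^`()^`() by ring.
by rewrite e -h; ring.
Qed.

(** For [d = 3] and more than 8 elements the degree bound makes [E] constant, so
    [4 E + H' ^ 2 - 2 H H''] is zero; its coefficient of degree 3 is [- 4 a b]. *)
Lemma cubic_square_valued (a b c d : K) : (8 < #|K|)%N ->
  (forall x, exists s, a * x ^+ 3 + b * x ^+ 2 + c * x + d = s ^+ 2) ->
  a * b = 0.
Proof.
move=> hq sq.
have [H HE] : exists H : {poly K},
    H = a%:P * 'X^3 + b%:P * 'X^2 + c%:P * 'X + d%:P by eexists.
have hH x : H.[x] = a * x ^+ 3 + b * x ^+ 2 + c * x + d.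
  by rewrite HE !(hornerD, hornerCM, hornerXn, hornerX, hornerC).
have H1 : H^`() = (2%:R * b)%:P * 'X + c%:P.
  rewrite HE !derivE /= polyCM polyC_natr.
  apply: (lincomb (e := 3%:R%:P * (a%:P * 'X^2))); first by rewrite c3 polyC0 mul0r.
  by rewrite polyC_natr; ring.
have H2 : H^`()^`() = (2%:R * b)%:P.
  by rewrite H1 !derivE /=; ring.
have sH : (size H <= 4)%N by rewrite HE size_cubic_leq.
have [->|nza] := eqVneq a 0; first by rewrite mul0r.
have nzH : H != 0.
  apply: contra_neq nza => H0.
  by have := congr1 (fun P : {poly K} => P`_3) HE; rewrite H0 !coefE /= !mulr0 !addr0 mulr1.
have sqH x : exists s, H.[x] = s ^+ 2 by rewrite hH.
have [T [E [_ ode2 sE]]] := square_valued_ode n2 (isT : (1 < 3)%N) sH sqH.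
have {}ode2 := ode_char3 nzH ode2.
have {}sE : (size E <= 1)%N.
  have [->|/sE] := eqVneq E 0; first by rewrite size_poly0.
  by move: (size E); move: hq; lia.
rewrite H2 H1 (size1_polyC sE) in ode2.
set e := E`_0 in ode2.
pose s := [:: 4%:R * e + c ^+ 2 - 4%:R * b * d; 0 ; 0; - 4%:R * a * b].
have : s`_3 = 0.
  apply: coefs_vanish => [|x]; first by rewrite (leq_trans _ hq).
  have := congr1 (fun P : {poly K} => P.[x]) ode2.
  rewrite HE derivC mulr0 mulr0 horner0 -!polyC_natr.
  rewrite !(hornerD, hornerN, hornerM, horner_exp, hornerXn, hornerX, hornerC) horner_Poly /=
    => h.
  by rewrite [RHS]h; ring.
rewrite /= => /eqP; rewrite -mulrA mulf_eq0 oppr_eq0 (natrX _ 2 2) expf_eq0 /= (negPf n2) =>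
  /eqP//.
Qed.

(** The conclusion says that the quartic is [(x ^ 2 - a) ^ 2]. Since no value is zero, [H] is
    coprime to [W], so the first equation makes [H] divide [E]. Then [H' ^ 2 = H S] with [S] of
    degree at most 2, and coefficients are compared. *)
Lemma quartic_nonzero_square_valued (a b c : K) : (8 < #|K|)%N ->
  (forall x, exists2 s, s != 0 & x ^+ 4 + a * x ^+ 2 + b * x + c = s ^+ 2) ->
  b = 0 /\ c = a ^+ 2.
Proof.
move=> hq sq.
have [H HE] : exists H : {poly K},
    H = 'X^4 + 0%:P * 'X^3 + a%:P * 'X^2 + b%:P * 'X + c%:P by eexists.
have hH x : H.[x] = x ^+ 4 + a * x ^+ 2 + b * x + c.
  by rewrite HE !(hornerD, hornerCM, hornerXn, hornerX, hornerC); ring.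
have H1 : H^`() = 4%:R%:P * 'X^3 + 0%:P * 'X^2 + (2%:R * a)%:P * 'X + b%:P.
  by rewrite HE !derivE /= !(polyCM, polyC_natr, polyC0); ring.
have sH : size H = 5 by rewrite HE size_quartic.
have nzH : H != 0 by rewrite -size_poly_eq0 sH.
have s1 : (size H^`() <= 4)%N by rewrite H1 size_cubic_leq.
have s2 : (size H^`()^`() <= 3)%N.
  have [->|nz] := eqVneq H^`() 0; first by rewrite deriv0 size_poly0.
  by have := lt_size_deriv nz; move: s1; move: (size _) (size _) => x y; lia.
have sqH x : exists s, H.[x] = s ^+ 2 by rewrite hH; have [s _ ->] := sq x; exists s.
have [T [E [ode1 ode2 sE]]] := square_valued_ode n2 (isT : (1 < 4)%N) (eq_leq sH) sqH.
have sR := ode_bound_quartic (eq_leq sH) s1 s2 sE.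
have [_ E0] := mulW_small (ode_char3 nzH ode2) (leq_trans sR (ltnW (ltnW hq))).
have cop : coprimep H W.
  rewrite finField_genPoly; elim/big_rec: _ => [|x P _ IH]; first exact: coprimep1.
  rewrite coprimepMr IH andbT coprimep_XsubC /root hH; have [s nzs ->] := sq x.
  by rewrite expf_eq0.
have /dvdpP[Q EQ] : H %| E by rewrite -(Gauss_dvdpr _ cop) ode1 dvdp_mulIl.
have HQ : H^`() ^+ 2 = H * (2%:R * H^`()^`() - 4%:R * Q).
  by rewrite EQ in E0; apply: (lincomb E0); ring.
move: HQ; set S := (X in _ = _ * X); move=> HS.
have sS : (size S <= 3)%N.
  have [->|nzS] := eqVneq S 0; first by rewrite size_poly0.
  have := congr1 (fun P : {poly K} => size P) HS; rewrite (size_mul nzH nzS) sH.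
  have := size_polyMleq H^`() H^`(); rewrite -expr2.
  by move: s1; move: (size _) (size _) (size _) => x y z; lia.
have SE x : S.[x] = S`_0 + S`_1 * x + S`_2 * x ^+ 2.
  rewrite (horner_coef_wide x sS) !big_ord_recl big_ord0 /=.
  by rewrite /bump /=; ring.
pose s0 := S`_0; pose t1 := S`_1; pose t2 := S`_2.
pose s := [:: b ^+ 2 - c * s0;
  4%:R * a * b - b * s0 - c * t1;
  4%:R * a ^+ 2 - a * s0 - b * t1 - c * t2;
  8%:R * b - a * t1 - b * t2;
  16%:R * a - s0 - a * t2;
  - t1;
  16%:R - t2].
have s00 : forall i, s`_i = 0.
  apply: coefs_vanish => [|x]; first by rewrite (leq_trans _ hq).
  have := congr1 (fun P : {poly K} => P.[x]) HS.
  rewrite horner_exp hornerM hH SE -/s0 -/t1 -/t2 H1.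
  rewrite !(hornerD, hornerCM, hornerXn, hornerX, hornerC) horner_Poly /= => h.
  by move/eqP: h; rewrite -subr_eq0 => /eqP h; apply: (lincomb h); ring.
have /= y6 := s00 6; have /= y5 := s00 5; have /= y4 := s00 4.
have /= y3 := s00 3; have /= y2 := s00 2.
have z6 : t2 = 16%:R by apply: (lincomb (e := - (16%:R - t2))); [by rewrite y6 oppr0 | ring].
have z5 : t1 = 0 by apply: (lincomb (e := - - t1)); [by rewrite y5 oppr0 | ring].
have z4 : s0 = 0.
  apply: (lincomb (e := - (16%:R * a - s0 - a * t2))); first by rewrite y4 oppr0.
  by rewrite z6; ring.
have z3 : b = 0.
  apply: (lincomb (e := (8%:R * b - a * t1 - b * t2) + 3%:R * (3%:R * b))).
    by rewrite y3 c3 mul0r addr0.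
  by rewrite z6 z5; ring.
split=> //.
apply: (lincomb (e := - (4%:R * a ^+ 2 - a * s0 - b * t1 - c * t2) + 3%:R * (a ^+ 2
  - 5%:R * c))).
  by rewrite y2 c3 mul0r addr0 oppr0.
by rewrite z6 z5 z4; ring.
Qed.

End CharThree.
End SquareValuedQuartic.
(** * Pairs of binary cubic forms *)

Section BinaryCubics.
Variable K : finFieldType.
Implicit Types (a b : K -> K -> K) (A B r c k : K).

Definition cub A0 A1 A2 A3 (u v : K) : K :=
  A0 * u ^+ 3 + A1 * u ^+ 2 * v + A2 * u * v ^+ 2 + A3 * v ^+ 3.

Definition complete2 a b : Prop :=
  (forall u v u' v', a u v = a u' v' -> b u v = b u' v' -> u = u' /\ v = v') /\
  (forall u v u' v', a u v + u = a u' v' + u' -> b u v + v = b u' v' + v' ->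
     u = u' /\ v = v').

(* [(a', b')] is [(a, b)] rewritten in the basis [(x1, y1), (x2, y2)]. *)
Definition conj2 a b a' b' : Prop :=
  exists x1 y1 x2 y2 : K, x1 * y2 - x2 * y1 != 0 /\
  forall u v,
    a (u * x1 + v * x2) (u * y1 + v * y2) = x1 * a' u v + x2 * b' u v /\
    b (u * x1 + v * x2) (u * y1 + v * y2) = y1 * a' u v + y2 * b' u v.

Lemma conj2_trans a b a' b' a'' b'' :
  conj2 a b a' b' -> conj2 a' b' a'' b'' -> conj2 a b a'' b''.
Proof.
move=> [x1 [y1 [x2 [y2 [nz h]]]]] [x1' [y1' [x2' [y2' [nz' h']]]]].
exists (x1' * x1 + y1' * x2), (x1' * y1 + y1' * y2),
  (x2' * x1 + y2' * x2), (x2' * y1 + y2' * y2); split.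
  have -> : (x1' * x1 + y1' * x2) * (x2' * y1 + y2' * y2) -
     (x2' * x1 + y2' * x2) * (x1' * y1 + y1' * y2) =
     (x1 * y2 - x2 * y1) * (x1' * y2' - x2' * y1') by ring.
  by rewrite mulf_neq0.
move=> u v; have [h1 h2] := h' u v.
have [h3 h4] := h (u * x1' + v * x2') (u * y1' + v * y2').
have e1 : u * (x1' * x1 + y1' * x2) + v * (x2' * x1 + y2' * x2) =
  (u * x1' + v * x2') * x1 + (u * y1' + v * y2') * x2 by ring.
have e2 : u * (x1' * y1 + y1' * y2) + v * (x2' * y1 + y2' * y2) =
  (u * x1' + v * x2') * y1 + (u * y1' + v * y2') * y2 by ring.
by rewrite e1 e2 h3 h4 h1 h2; split; ring.
Qed.

Lemma solve2 (x1 y1 x2 y2 u v u' v' : K) : x1 * y2 - x2 * y1 != 0 ->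
  u * x1 + v * x2 = u' * x1 + v' * x2 ->
  u * y1 + v * y2 = u' * y1 + v' * y2 -> u = u' /\ v = v'.
Proof.
move=> nz e1 e2.
pose d1 := u * x1 + v * x2 - (u' * x1 + v' * x2).
pose d2 := u * y1 + v * y2 - (u' * y1 + v' * y2).
have z1 : d1 = 0 by rewrite /d1 e1 subrr.
have z2 : d2 = 0 by rewrite /d2 e2 subrr.
split; apply: (mulfI nz).
  apply: (lincomb (e := y2 * d1 - x2 * d2)); first by rewrite z1 z2 !mulr0 subrr.
  by rewrite /d1 /d2; ring.
apply: (lincomb (e := x1 * d2 - y1 * d1)); first by rewrite z1 z2 !mulr0 subrr.
by rewrite /d1 /d2; ring.
Qed.

Lemma conj2_complete a b a' b' :
  complete2 a b -> conj2 a b a' b' -> complete2 a' b'.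
Proof.
move=> [i1 i2] [x1 [y1 [x2 [y2 [nz h]]]]]; split=> u v u' v' e1 e2.
  have [h1 h2] := h u v; have [h3 h4] := h u' v'.
  have [] := i1 (u * x1 + v * x2) (u * y1 + v * y2) (u' * x1 + v' * x2) (u' * y1 + v' * y2).
  - by rewrite h1 h3 e1 e2.
  - by rewrite h2 h4 e1 e2.
  exact: solve2.
have [h1 h2] := h u v; have [h3 h4] := h u' v'.
have [] := i2 (u * x1 + v * x2) (u * y1 + v * y2) (u' * x1 + v' * x2) (u' * y1 + v' * y2).
- rewrite h1 h3.
  have -> : a' u' v' = a' u v + u - u' by rewrite e1 addrK.
  have -> : b' u' v' = b' u v + v - v' by rewrite e2 addrK.
  by ring.
- rewrite h2 h4.
  have -> : a' u' v' = a' u v + u - u' by rewrite e1 addrK.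
  have -> : b' u' v' = b' u v + v - v' by rewrite e2 addrK.
  by ring.
exact: solve2.
Qed.

(** The new first basis vector is [(1, r)]: a condition on the coefficients that holds in every
    basis thereby becomes a polynomial in [r] vanishing on [K]. *)
Lemma conj2_shear_v r A0 A1 A2 A3 B0 B1 B2 B3 :
  conj2 (cub A0 A1 A2 A3) (cub B0 B1 B2 B3)
   (cub (A0 + A1 * r + A2 * r ^+ 2 + A3 * r ^+ 3)
        (A1 + 2%:R * A2 * r + 3%:R * A3 * r ^+ 2) (A2 + 3%:R * A3 * r) A3)
   (cub (B0 + B1 * r + B2 * r ^+ 2 + B3 * r ^+ 3
          - r * (A0 + A1 * r + A2 * r ^+ 2 + A3 * r ^+ 3))
        (B1 + 2%:R * B2 * r + 3%:R * B3 * r ^+ 2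
          - r * (A1 + 2%:R * A2 * r + 3%:R * A3 * r ^+ 2))
        (B2 + 3%:R * B3 * r - r * (A2 + 3%:R * A3 * r)) (B3 - r * A3)).
Proof.
exists 1, r, 0, 1; split; first by rewrite mulr1 mul0r subr0 oner_neq0.
by move=> u v; rewrite /cub; split; ring.
Qed.

Lemma conj2_shear_u c A0 A1 A2 A3 B0 B1 B2 B3 :
  conj2 (cub A0 A1 A2 A3) (cub B0 B1 B2 B3)
   (cub (A0 - c * B0) (A1 + 3%:R * A0 * c - c * (B1 + 3%:R * B0 * c))
        (A2 + 2%:R * A1 * c + 3%:R * A0 * c ^+ 2
          - c * (B2 + 2%:R * B1 * c + 3%:R * B0 * c ^+ 2))
        (A3 + A2 * c + A1 * c ^+ 2 + A0 * c ^+ 3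
          - c * (B3 + B2 * c + B1 * c ^+ 2 + B0 * c ^+ 3)))
   (cub B0 (B1 + 3%:R * B0 * c) (B2 + 2%:R * B1 * c + 3%:R * B0 * c ^+ 2)
        (B3 + B2 * c + B1 * c ^+ 2 + B0 * c ^+ 3)).
Proof.
exists 1, 0, c, 1; split; first by rewrite mulr1 mulr0 subr0 oner_neq0.
by move=> u v; rewrite /cub; split; ring.
Qed.

Lemma conj2_scale k A0 A1 A2 A3 B0 B1 B2 B3 : k != 0 ->
  conj2 (cub A0 A1 A2 A3) (cub B0 B1 B2 B3)
   (cub A0 (A1 * k) (A2 * k ^+ 2) (A3 * k ^+ 3))
   (cub (B0 / k) B1 (B2 * k) (B3 * k ^+ 2)).
Proof.
move=> nzk; exists 1, 0, 0, k; split; first by rewrite mul1r mul0r subr0.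
by move=> u v; rewrite /cub; split; [ring | field].
Qed.

Lemma conj2_swap A0 A1 A2 A3 B0 B1 B2 B3 :
  conj2 (cub A0 A1 A2 A3) (cub B0 B1 B2 B3) (cub B3 B2 B1 B0) (cub A3 A2 A1 A0).
Proof.
exists 0, 1, 1, 0; split; first by rewrite mul0r mul1r sub0r oppr_eq0 oner_neq0.
by move=> u v; rewrite /cub; split; ring.
Qed.

(* The basis [e1, f(e1)]; it exists as soon as [f(e1)] is not parallel to [e1]. *)
Lemma conj2_image_basis A0 A1 A2 A3 B0 B1 B2 B3 : B0 != 0 ->
  exists A1' A2' A3' B1' B2' B3',
  [/\ conj2 (cub A0 A1 A2 A3) (cub B0 B1 B2 B3) (cub 0 A1' A2' A3') (cub 1 B1' B2' B3'),
      B1' ^+ 2 - 3%:R * B2' = B1 ^+ 2 - 3%:R * B0 * B2 &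
      - A1' = A0 * B1 - A1 * B0].
Proof.
move=> nz; have h1 := conj2_shear_u (A0 / B0) A0 A1 A2 A3 B0 B1 B2 B3.
have := conj2_trans h1 (conj2_scale _ _ _ _ _ _ _ _ nz).
rewrite divff // divfK // subrr => h2.
by do 6!eexists; split; [exact: h2 | field | field].
Qed.

Section Complete.
Variables A0 A1 A2 A3 B0 B1 B2 B3 : K.
Hypothesis cp : complete2 (cub A0 A1 A2 A3) (cub B0 B1 B2 B3).

Lemma complete2_cube_inj (x y : K) : x ^+ 3 = y ^+ 3 -> x = y.
Proof.
move=> e; have [i1 _] := cp; have [] // := i1 x 0 y 0; rewrite /cub e; ring.
Qed.

Lemma complete2_coef0 : B0 = 0 -> A0 != 0.
Proof.
move=> b0; apply/eqP => a0; have [i1 _] := cp.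
have [||/eqP] := i1 1 0 0 0; last by rewrite oner_eq0.
  by rewrite /cub a0; ring.
by rewrite /cub b0; ring.
Qed.

(* Scaling the variables by [1 / z] turns the injectivity of [f + id] into
   that of [f + z^2 id]. *)
Lemma complete2_scaled z (u v u' v' : K) :
  cub A0 A1 A2 A3 u v + z ^+ 2 * u = cub A0 A1 A2 A3 u' v' + z ^+ 2 * u' ->
  cub B0 B1 B2 B3 u v + z ^+ 2 * v = cub B0 B1 B2 B3 u' v' + z ^+ 2 * v' ->
  u = u' /\ v = v'.
Proof.
have [i1 i2] := cp; have [->|nz] := eqVneq z 0.
  rewrite !expr0n !mul0r !addr0; exact: i1.
move=> e1 e2; have [] := i2 (u / z) (v / z) (u' / z) (v' / z).
- have h x y : cub A0 A1 A2 A3 (x / z) (y / z) + x / z =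
     (cub A0 A1 A2 A3 x y + z ^+ 2 * x) / z ^+ 3 by rewrite /cub; field.
  by rewrite !h e1.
- have h x y : cub B0 B1 B2 B3 (x / z) (y / z) + y / z =
     (cub B0 B1 B2 B3 x y + z ^+ 2 * y) / z ^+ 3 by rewrite /cub; field.
  by rewrite !h e2.
by move=> /divIf-> // /divIf->.
Qed.

End Complete.
End BinaryCubics.
(** * Characteristic different from 3 *)

Section CharNotThree.
Variable K : finFieldType.
Hypothesis n3 : (3%:R : K) != 0.

Lemma char2_sqrt (x : K) : (2%:R : K) = 0 -> exists s, x = s ^+ 2.
Proof.
move=> c2; have inj : injective (fun s : K => s ^+ 2).
  move=> s t /= e; apply/eqP; rewrite -subr_eq0 -sqrf_eq0; apply/eqP.
  apply: (lincomb (e := s ^+ 2 - t ^+ 2 + 2%:R * (t ^+ 2 - s * t))).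
    by rewrite e c2 subrr mul0r addr0.
  by ring.
by have [g _ gK] := injF_bij inj; exists (g x); rewrite gK.
Qed.

(** A square root [s] of -3 would give a cube root of unity [(s - 1) / 2] other than 1. *)
Lemma cube_inj_nonsquare (s : K) : (2%:R : K) != 0 ->
  (forall x y : K, x ^+ 3 = y ^+ 3 -> x = y) -> s ^+ 2 != - 3%:R.
Proof.
move=> n2 ci; apply/eqP => e.
have e0 : s ^+ 2 + 3%:R = 0 by rewrite e addNr.
have : (s - 1) / 2%:R = 1.
  apply: ci; rewrite expr1n.
  apply: (lincomb (e := (s - 3%:R) * (s ^+ 2 + 3%:R) / 8%:R)).
    by rewrite e0 mulr0 mul0r.
  by field; rewrite n2 (natrX _ 2 3) expf_neq0.
move/(congr1 (fun x => x * 2%:R)); rewrite divfK // mul1r => /eqP.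
rewrite subr_eq => /eqP s3; move/eqP: e0; rewrite s3.
have -> : (2%:R + 1) ^+ 2 + 3%:R = 2%:R ^+ 2 * 3%:R :> K by ring.
by rewrite mulf_eq0 expf_eq0 /= (negPf n2) (negPf n3).
Qed.

(** If [B0 = 0], then [(1, 0)] is mapped to a multiple of itself, and on its line [f + id] agrees at
    [x] and [y] as soon as [A0 (x ^ 2 + x y + y ^ 2) = -1]. *)
Lemma complete2_no_eigenvector (A0 A1 A2 A3 B0 B1 B2 B3 : K) :
  complete2 (cub A0 A1 A2 A3) (cub B0 B1 B2 B3) -> B0 != 0.
Proof.
move=> cp; apply/eqP => b0; have nzA := complete2_coef0 cp b0.
have [x [y [nexy e]]] : exists x y : K, x != y /\ A0 * (x ^+ 2 + x * y + y ^+ 2) = - 1.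
  have [c2|n2] := eqVneq (2%:R : K) 0.
    have [s sE] := char2_sqrt (- A0^-1) c2.
    exists s, 0; split; last by rewrite mulr0 expr0n !addr0 -sE mulrN divff.
    by apply/eqP => s0; move/eqP: sE; rewrite s0 expr0n oppr_eq0 invr_eq0 (negPf nzA).
  (* For [x = s + t] and [y = s - t] the form is [3 s ^ 2 + t ^ 2]; if [t = 0], the pair [s],
     [- 2 s] has the same value and distinct entries. *)
  have [s [t e]] := quadric_solvable (- A0^-1) n2 n3 (oner_neq0 K).
  have [t0|nzt] := eqVneq t 0.
    exists s, (- 2%:R * s); split.
      apply/eqP => e1; have : 3%:R * s = 0.
        by apply: (lincomb (e := s - - 2%:R * s)); [rewrite {1}e1 subrr | ring].
      move/eqP; rewrite mulf_eq0 (negPf n3) /= => /eqP s0.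
      by move/eqP: e; rewrite s0 t0 expr0n !mulr0 addr0 eq_sym oppr_eq0 invr_eq0 (negPf nzA).
    apply: (mulfI (invr_neq0 nzA)); rewrite mulKf // mulrN mulr1 -e t0; ring.
  exists (s + t), (s - t); split.
    rewrite -subr_eq0; have -> : s + t - (s - t) = 2%:R * t by ring.
    by rewrite mulf_neq0.
  apply: (mulfI (invr_neq0 nzA)); rewrite mulKf // mulrN mulr1 -e; ring.
have [_ i2] := cp; case/eqP: nexy; have [] // := i2 x 0 y 0; last by rewrite /cub b0; ring.
rewrite /cub; apply: (lincomb (e := (x - y) * (A0 * (x ^+ 2 + x * y + y ^+ 2) + 1))).
  by rewrite e addNr mulr0.
by ring.
Qed.

Section OddImageBasis.
Variables A1 A2 A3 B1 B2 B3 : K.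
Hypothesis cp : complete2 (cub 0 A1 A2 A3) (cub 1 B1 B2 B3).
Hypothesis n2 : (2%:R : K) != 0.

(** Under these equations [f + z ^ 2 id] agrees at [(w + t, v)] and [(w - t, v)]. *)
Lemma complete2_no_square (w v t z : K) :
  3%:R * w ^+ 2 + t ^+ 2 + 2%:R * B1 * w * v + B2 * v ^+ 2 = 0 ->
  2%:R * A1 * w * v + A2 * v ^+ 2 = - z ^+ 2 -> t = 0.
Proof.
move=> e1 e2; have [] := @complete2_scaled _ _ _ _ _ _ _ _ _ cp z (w + t) v (w - t) v.
- rewrite /cub; apply: (lincomb (e := 2%:R * t * (2%:R * A1 * w * v + A2 * v ^+ 2 + z ^+ 2))).
    by rewrite e2 addNr mulr0.
  by ring.
- rewrite /cub; apply: (lincomb (e := 2%:R * t * (3%:R * w ^+ 2 + t ^+ 2 + 2%:R * B1 * w * v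
  + B2 * v ^+ 2))).
    by rewrite e1 mulr0.
  by ring.
move=> /addrI /eqP; rewrite -subr_eq0 opprK -mulr2n -mulr_natl mulf_eq0 (negPf n2) /= => /eqP
  //.
Qed.

(** By [complete2_no_square], [- P] is not a nonzero square; -3 is not a square because cubing is
    injective; and two non-squares have a square quotient. *)
Lemma complete2_square_value (w z : K) : 2%:R * A1 * w + A2 = - z ^+ 2 ->
  exists s, (3%:R * w ^+ 2 + 2%:R * B1 * w + B2) / 3%:R = s ^+ 2.
Proof.
move=> e; set P := _ + B2.
have n3' : - 3%:R != 0 :> K by rewrite oppr_eq0.
have [[s sE]|[[s sE]|[s sE]]] := square_or (- P) n3'.
- exists 0; suff s0 : s = 0 by rewrite -[P]opprK sE s0 expr0n oppr0 mul0r.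
  apply: (complete2_no_square (w := w) (v := 1) (z := z)); last by rewrite !mulr1 expr1n mulr1.
  by rewrite -sE /P; ring.
- by have := cube_inj_nonsquare s n2 (@complete2_cube_inj _ _ _ _ _ _ _ _ _ cp);
  rewrite sE eqxx.
- by exists s; rewrite -sE invrN mulrNN.
Qed.

Lemma complete2_disc_or : (10 < #|K|)%N ->
  B1 ^+ 2 = 3%:R * B2 \/ (A1 = 0 /\ A2 != 0).
Proof.
move=> hq; have n9 : 9%:R != 0 :> K by rewrite (natrX _ 3 2) expf_neq0.
have n4 : 4%:R != 0 :> K by rewrite (natrX _ 2 2) expf_neq0.
have [a1|nz1] := eqVneq A1 0.
  have [a2|nz2] := eqVneq A2 0; [left|by right].
  (* Here [z = 0] suits every [w], and [w = x ^ 2] produces an even quartic. *)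
  have h := quartic_square_valued n2 (h2 := 2%:R * B1 / 3%:R) (h0 := B2 / 3%:R) n3 hq.
  have {}h : (2 * B1 / 3%:R) ^+ 2 = 4%:R * (B2 / 3%:R).
    apply: h => x; have [|s sE] := @complete2_square_value (x ^+ 2) 0.
      by rewrite a1 a2; ring.
    by exists s; rewrite -sE; field.
  apply: (mulfI n4); apply: (mulIf (invr_neq0 n9)).
  transitivity ((2 * B1 / 3%:R) ^+ 2); first by field; rewrite n3 n9.
  by rewrite h; field; rewrite n3 n9.
(* Solving [2 A1 w + A2 = - x ^ 2] for [w] and multiplying by [(2 A1) ^ 2] again gives an even
   quartic in [x]. *)
left; pose c := 4%:R * A1 * B1 / 3%:R.
have h := quartic_square_valued n2 (h2 := 2%:R * A2 - c)
  (h0 := A2 ^+ 2 - c * A2 + 4%:R * A1 ^+ 2 * B2 / 3%:R) n3 hq.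
have {}h : (2%:R * A2 - c) ^+ 2 = 4%:R * (A2 ^+ 2 - c * A2 + 4%:R * A1 ^+ 2 * B2 / 3%:R).
  apply: h => x; have [|s sE] := @complete2_square_value (- (x ^+ 2 + A2) / (2%:R * A1)) x.
    by field; rewrite n2 nz1.
  exists (2%:R * A1 * s); rewrite exprMn -sE /c; field; rewrite n2 n3 nz1 //.
have nk : 16%:R * A1 ^+ 2 / 9%:R != 0 :> K.
  by rewrite mulf_neq0 ?invr_eq0 // mulf_neq0 ?expf_neq0 // (natrX _ 2 4) expf_neq0.
apply: (mulfI nk).
move/eqP: h; rewrite -subr_eq0 => /eqP h.
apply: (lincomb h); rewrite /c; field; rewrite n3 n9 //.
Qed.
End OddImageBasis.

(* The two conditions are invariant under changes of the second basis vector; the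
   second one says that the Jacobian of [(A, B)] vanishes at [(1, 0)]. *)
Lemma complete2_disc_jac (A0 A1 A2 A3 B0 B1 B2 B3 : K) :
  (2%:R : K) != 0 -> (10 < #|K|)%N ->
  complete2 (cub A0 A1 A2 A3) (cub B0 B1 B2 B3) ->
  B1 ^+ 2 - 3%:R * B0 * B2 = 0 \/ A0 * B1 - A1 * B0 = 0.
Proof.
move=> n2 hq cp; have nzB := complete2_no_eigenvector cp.
have [A1' [A2' [A3' [B1' [B2' [B3' [cj <- <-]]]]]]] :=
  conj2_image_basis A0 A1 A2 A3 B1 B2 B3 nzB.
have [->|[-> _]] := complete2_disc_or (conj2_complete cp cj) n2 hq; [left|right].
  exact: subrr.
exact: oppr0.
Qed.

(** The alternative of [complete2_disc_jac] holds in every direction, so discriminant times Jacobian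
    is a polynomial of degree at most 7 vanishing on [K]. In the case left open by
    [complete2_disc_or] the Jacobian polynomial is nonzero, so the discriminant vanishes
    identically. *)
Lemma complete2_disc_odd (A0 A1 A2 A3 B0 B1 B2 B3 : K) :
  (2%:R : K) != 0 -> (10 < #|K|)%N ->
  complete2 (cub A0 A1 A2 A3) (cub B0 B1 B2 B3) -> B1 ^+ 2 = 3%:R * B0 * B2.
Proof.
move=> n2 hq cp; have nzB := complete2_no_eigenvector cp.
have [a1 [a2 [a3 [b1 [b2 [b3 [cj dE _]]]]]]] := conj2_image_basis A0 A1 A2 A3 B1 B2 B3 nzB.
apply/eqP; rewrite -subr_eq0 -dE; apply/eqP.
have cp' := conj2_complete cp cj.
have [->|[a10 nza2]] := complete2_disc_or cp' n2 hq; first exact: subrr.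
subst a1.
(* [PD] and [PJ] are the discriminant and the Jacobian in the direction [(r, 1)];
   the leading coefficient of [PD] is the discriminant in the direction [(1, 0)]. *)
pose PD := Poly [:: a2 ^+ 2; - 2%:R * a2 * b2 + 3%:R * a3 * b1;
  b2 ^+ 2 - 4%:R * a2 * b1 + 9%:R * a3 + 3%:R * (a2 - b3) * b1;
  - 6%:R * a2 + b1 * b2 + 9%:R * (a2 - b3); b1 ^+ 2 - 3%:R * b2].
pose PJ := Poly [:: b3 * a2 - b2 * a3; - 2%:R * b1 * a3; - b1 * a2 - 3%:R * a3; - 2%:R * a2].
have : PD * PJ = 0.
  apply: poly_vanish => [|r].
    rewrite (leq_trans (size_polyMleq _ _)) //.
    have sD : (size PD <= 5)%N by exact: size_Poly.
    have sJ : (size PJ <= 4)%N by exact: size_Poly.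
    by move: (size PD) (size PJ) sD sJ hq => x y; lia.
  have cj2 := conj2_trans (conj2_swap _ _ _ _ _ _ _ _) (conj2_shear_v r _ _ _ _ _ _ _ _).
  have [D0|J0] := complete2_disc_jac n2 hq (conj2_complete cp' (cj2 _ _ _ _ _ _ _ _));
    rewrite hornerM; apply/eqP; rewrite mulf_eq0; apply/orP; [left|right]; apply/eqP.
    by apply: etrans D0; rewrite horner_Poly /=; ring.
  by apply: etrans J0; rewrite horner_Poly /=; ring.
move/eqP; rewrite mulf_eq0 => /orP[]/eqP P0.
  by have := congr1 (fun P : {poly K} => P`_4) P0; rewrite coef_Poly coef0.
have := congr1 (fun P : {poly K} => P`_3) P0; rewrite coef_Poly coef0 /= => /eqP.
by rewrite mulf_eq0 oppr_eq0 (negPf n2) (negPf nza2).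
Qed.

(** Every element is a square here. If [t ^ 2 = b2] and [t + b1] is nonzero, the chosen [u], [v],
    [z] make [f + z ^ 2 id] agree at [(u + 1, v)] and [(u, v)]. *)
Lemma complete2_disc_char2 (A0 A1 A2 A3 B0 B1 B2 B3 : K) :
  (2%:R : K) = 0 ->
  complete2 (cub A0 A1 A2 A3) (cub B0 B1 B2 B3) -> B1 ^+ 2 = 3%:R * B0 * B2.
Proof.
move=> c2 cp; have nzB := complete2_no_eigenvector cp.
have [a1 [a2 [a3 [b1 [b2 [b3 [cj dE _]]]]]]] := conj2_image_basis A0 A1 A2 A3 B1 B2 B3 nzB.
apply/eqP; rewrite -subr_eq0 -dE; apply/eqP.
have cp' := conj2_complete cp cj.
have [t tE] := char2_sqrt b2 c2; have [e|ne] := eqVneq (t + b1) 0.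
  rewrite tE; apply: (lincomb (e := (t + b1) * (b1 - t) - 2%:R * t ^+ 2)).
    by rewrite e c2 !mul0r subrr.
  by ring.
pose v := - (t + b1)^-1; pose u := t * v.
have [z zE] := char2_sqrt (- (a1 * v + a2 * v ^+ 2)) c2.
have [] := @complete2_scaled _ _ _ _ _ _ _ _ _ cp' z (u + 1) v u v.
- rewrite -zE /cub; apply: (lincomb (e := 2%:R * (a1 * u * v))).
    by rewrite c2 mul0r.
  by ring.
- rewrite /cub tE; apply: (lincomb (e := 2%:R * (u ^+ 2 + u + u * v * b1 + t ^+ 2 * v ^+ 2))).
    by rewrite c2 mul0r.
  by rewrite /u /v; field.
by move/eqP; rewrite -subr_eq0 addrAC subrr add0r oner_eq0.
Qed.

End CharNotThree.

(** * Exhaustive tests over prime fields *)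

Section PrimeFieldTest.
Local Open Scope nat_scope.
Variable p : nat.
Definition mulm x y := (x * y) %% p.

Definition cubm a0 a1 a2 a3 u v :=
  let u2 := mulm u u in let v2 := mulm v v in
  (mulm a0 (mulm u2 u) + mulm a1 (mulm u2 v) + mulm a2 (mulm u v2)
    + mulm a3 (mulm v2 v)) %% p.

Definition points := [seq (u, v) | u <- iota 0 p, v <- iota 0 p].

(** Elements are represented by natural numbers below [p], so that injectivity becomes a computable
    [uniq]. *)
Definition complete_test a0 a1 a2 a3 b0 b1 b2 b3 :=
  let vals := [seq (w, (cubm a0 a1 a2 a3 w.1 w.2, cubm b0 b1 b2 b3 w.1 w.2)) | w <- points] in
  uniq [seq ((w.2.1 + w.1.1) %% p, (w.2.2 + w.1.2) %% p) | w <- vals] &&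
  uniq [seq w.2 | w <- vals].

Definition alli (P : pred nat) := all P (iota 0 p).

Lemma alliP (P : pred nat) x : alli P -> x < p -> P x.
Proof. by move=> /allP h xp; apply: h; rewrite mem_iota. Qed.

Local Open Scope ring_scope.
Variable K : finFieldType.
Hypothesis pr_p : prime p.
Hypothesis cK : #|K| = p.

Lemma natr_p : (p%:R : K) = 0.
Proof. by rewrite -cK natr_card. Qed.

Lemma natr_modp n : ((n %% p)%:R : K) = n%:R.
Proof. by rewrite {2}(divn_eq n p) natrD natrM natr_p mulr0 add0r. Qed.

Lemma natr_inj m n : (m < p)%N -> (n < p)%N -> (m%:R : K) = n%:R -> m = n.
Proof.
have cp : p \in [pchar K] by apply: (@card_finPcharP K p 1); rewrite ?expn1.
wlog le_mn : m n / (m <= n)%N.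
  by move=> h mp np e; case: (leqP m n) => [|/ltnW] le; [|symmetry]; apply: h.
move=> mp np e; have : ((n - m)%:R : K) == 0 by rewrite natrB // e subrr.
rewrite -(dvdn_pcharf cp) => dv;
case: (posnP (n - m)) => h; first by lia.
by have := dvdn_leq h dv; lia.
Qed.

Lemma natr_surj (x : K) : exists2 n, (n < p)%N & x = n%:R.
Proof.
have inj : injective (fun i : 'I_p => (i%:R : K)).
  by move=> i j /natr_inj e; apply: val_inj; apply: e.
have := inj_card_onto inj; rewrite card_ord cK => /(_ (leqnn p) x).
case/codomP => i ->; exists (i : nat); [exact: ltn_ord|by []].
Qed.

Lemma cubmE a0 a1 a2 a3 u v :
  (cubm a0 a1 a2 a3 u v)%:R = cub a0%:R a1%:R a2%:R a3%:R u%:R v%:R :> K.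
Proof.
rewrite /cubm /mulm natr_modp !natrD !natr_modp !natrM !natr_modp !natrM !natr_modp !natrM.
by rewrite /cub; ring.
Qed.

Lemma complete_testP a0 a1 a2 a3 b0 b1 b2 b3 :
  complete2 (cub (a0%:R : K) a1%:R a2%:R a3%:R) (cub b0%:R b1%:R b2%:R b3%:R) ->
  complete_test a0 a1 a2 a3 b0 b1 b2 b3.
Proof.
move=> [i1 i2].
have up : uniq points.
  by apply: allpairs_uniq; rewrite ?iota_uniq // => -[x y] [z t].
have ptP w : w \in points -> (w.1 < p)%N /\ (w.2 < p)%N.
  by case/allpairsP => -[x y] /= []; rewrite !mem_iota /= => hx hy ->.
rewrite /complete_test -!map_comp !map_inj_in_uniq ?up //.
  move=> [u v] [u' v'] /ptP /= [hu hv] /ptP /= [hu' hv'] [e1 e2].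
  have [] := i1 u%:R v%:R u'%:R v'%:R; rewrite -?cubmE ?e1 ?e2 //.
  by move=> /natr_inj-> // /natr_inj->.
move=> [u v] [u' v'] /ptP /= [hu hv] /ptP /= [hu' hv'] [e1 e2].
have [] := i2 u%:R v%:R u'%:R v'%:R.
- by rewrite -!cubmE -!natrD -natr_modp e1 natr_modp.
- by rewrite -!cubmE -!natrD -natr_modp e2 natr_modp.
by move=> /natr_inj-> // /natr_inj->.
Qed.

End PrimeFieldTest.

(** The constants [0] and [1] come from the basis of [conj2_image_basis]; six coefficients remain to
    enumerate. *)
Definition disc_test5 :=
  alli 5 (fun b1 => alli 5 (fun b2 => (mulm 5 b1 b1 == mulm 5 3 b2) ||
    alli 5 (fun a1 => alli 5 (fun a2 => alli 5 (fun a3 => alli 5 (fun b3 =>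
      ~~ complete_test 5 0 a1 a2 a3 1 b1 b2 b3)))))).

Lemma disc_test5_true : disc_test5.
Proof. by vm_compute. Qed.

(** * Normal form in characteristic different from 3 *)

Section NormalFormNotThree.
Variable K : finFieldType.
Hypothesis n3 : (3%:R : K) != 0.

Lemma complete2_disc5 (A0 A1 A2 A3 B0 B1 B2 B3 : K) : #|K| = 5%N ->
  complete2 (cub A0 A1 A2 A3) (cub B0 B1 B2 B3) -> B1 ^+ 2 = 3%:R * B0 * B2.
Proof.
move=> cK cp; have nzB := complete2_no_eigenvector n3 cp.
have [C1 [C2 [C3 [D1 [D2 [D3 [cj dE _]]]]]]] := conj2_image_basis A0 A1 A2 A3 B1 B2 B3 nzB.
apply/eqP; rewrite -subr_eq0 -dE subr_eq0; apply/eqP.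
have {cj} := conj2_complete cp cj; have sj := natr_surj (isT : prime 5) cK.
have [c1 h1 ->] := sj C1; have [c2 h2 ->] := sj C2; have [c3 h3 ->] := sj C3.
have [d1 g1 ->] := sj D1; have [d2 g2 ->] := sj D2; have [d3 g3 ->] := sj D3.
move/(complete_testP (a0 := 0) (b0 := 1) (isT : prime 5) cK) => ct.
have /orP[/eqP e|] := alliP (alliP disc_test5_true g1) g2.
  have := congr1 (fun n => n%:R : K) e.
  by rewrite /mulm !(natr_modp cK) natrM => e'; rewrite expr2 e' natrM.
by move=> /alliP/(_ h1)/alliP/(_ h2)/alliP/(_ h3)/alliP/(_ g3); rewrite ct.
Qed.

Lemma complete2_disc (A0 A1 A2 A3 B0 B1 B2 B3 : K) :
  complete2 (cub A0 A1 A2 A3) (cub B0 B1 B2 B3) -> B1 ^+ 2 = 3%:R * B0 * B2.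
Proof.
move=> cp; have [c2|n2] := eqVneq (2%:R : K) 0; first exact: complete2_disc_char2 c2 cp.
have [|hq] := ltnP 10 #|K|; first by move=> hq; apply: complete2_disc_odd hq cp.
have [m cK] := card_odd n2; have q0 := natr_card K; have q1 := finNzRing_gt1 K.
(* Cardinality 3 or 9 contradicts [n3], 5 is the enumerated case, and with 7 elements [2 ^ 3 = 1]
   contradicts the injectivity of cubing. *)
have : #|K| \in [:: 3; 5; 7; 9]%N.
  by move: hq q1; rewrite cK; case: m {cK} => [|[|[|[|[|m]]]]] //; rewrite ltnNge; lia.
rewrite !inE => /or4P[]/eqP e; rewrite e in q0.
- by case/eqP: n3.
- exact: complete2_disc5 e cp.
- have /(complete2_cube_inj cp)/eqP : (2%:R : K) ^+ 3 = 1 ^+ 3.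
    by apply: (lincomb q0); ring.
  by rewrite -subr_eq0 -[X in _ - X]/(1%:R) -natrB // oner_eq0.
- by case/eqP: n3; apply/eqP; rewrite -sqrf_eq0 -natrX q0.
Qed.

Lemma conj2_ext (a b a' b' a'' b'' : K -> K -> K) :
  (forall u v, a' u v = a'' u v) -> (forall u v, b' u v = b'' u v) ->
  conj2 a b a' b' -> conj2 a b a'' b''.
Proof.
move=> ea eb [x1 [y1 [x2 [y2 [nz h]]]]]; exists x1, y1, x2, y2; split=> // u v.
by rewrite -ea -eb.
Qed.

(** The discriminant in the direction [(1, r)] has degree at most 4 in [r], so over more than 4
    elements all its coefficients vanish; these equations determine [f] up to one parameter. *)
Lemma complete2_normal_form (A0 A1 A2 A3 B0 B1 B2 B3 : K) : (4 < #|K|)%N ->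
  complete2 (cub A0 A1 A2 A3) (cub B0 B1 B2 B3) ->
  exists2 m, m != 0 & conj2 (cub A0 A1 A2 A3) (cub B0 B1 B2 B3)
    (fun u v => m * (2%:R * u - v) * (u ^+ 2 - u * v + v ^+ 2))
    (fun u v => m * (u + v) * (u ^+ 2 - u * v + v ^+ 2)).
Proof.
move=> hq cp; have nzB := complete2_no_eigenvector n3 cp.
(* As [3 B0] is invertible, a shear removes [B1]; a scaling then makes the leading coefficient 1,
   and the discriminant in the direction [(1, 0)] will give [b2 = 0]. *)
have [a0 [a1 [a2 [a3 [b2 [b3 cj]]]]]] : exists a0 a1 a2 a3 b2 b3,
    conj2 (cub A0 A1 A2 A3) (cub B0 B1 B2 B3) (cub a0 a1 a2 a3) (cub 1 0 b2 b3).
  have := conj2_trans (conj2_shear_u (- B1 / (3%:R * B0)) A0 A1 A2 A3 B0 B1 B2 B3)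
    (conj2_scale _ _ _ _ _ _ _ _ nzB).
  rewrite divff //.
  have -> : B1 + 3%:R * B0 * (- B1 / (3%:R * B0)) = 0 by field; rewrite n3 nzB.
  by move=> h; do 6!eexists; exact: h.
have cp1 := conj2_complete cp cj.
have b20 : b2 = 0.
  have /eqP := complete2_disc cp1; rewrite expr0n /= eq_sym mulr1 mulf_eq0.
  by rewrite (negPf n3) => /eqP.
subst b2.
pose s := [:: 0; - (9%:R * b3 - 3%:R * a2);
  a1 ^+ 2 + 9%:R * a3 + 3%:R * a0 * (3%:R * b3 - a2);
  2%:R * a1 * a2 - 9%:R * a0 * a3 + a1 * (3%:R * b3 - a2); a2 ^+ 2 - 3%:R * a1 * a3].
have s0 i : s`_i = 0.
  apply: coefs_vanish => // r.
  have := complete2_disc (conj2_complete cp1 (conj2_shear_v r _ _ _ _ _ _ _ _)).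
  move/eqP; rewrite -subr_eq0 => /eqP h.
  by rewrite horner_Poly /=; apply: (lincomb h); ring.
have /= s1 := s0 1%N; have /= s2 := s0 2%N; have /= s3 := s0 3%N; have /= s4 := s0 4%N.
have a2E : a2 = 3%:R * b3.
  by apply: (mulfI n3); apply: (lincomb s1); ring.
rewrite {}a2E in s1 s2 s3 s4 cj cp1 s s0 *.
have n9 : 9%:R != 0 :> K by rewrite (natrX _ 3 2) expf_neq0.
have a3E : a3 = - a1 ^+ 2 / 9%:R.
  by apply: (mulfI n9); apply: (lincomb s2); field.
rewrite {}a3E in s2 s3 s4 cj cp1 s s0 *.
(* If [a1 = 0], then [a3] and [b3] vanish and [f] sends [(0, 1)] to zero. *)
have [a10|nza1] := eqVneq a1 0.
  have b30 : b3 = 0.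
    apply/eqP; rewrite -sqrf_eq0; apply/eqP; apply: (mulfI n9).
    by rewrite mulr0 -s4 a10; ring.
  have [i1 _] := cp1; have [||_ /eqP] := i1 0 1 0 0; last by rewrite oner_eq0.
    by rewrite /cub a10 b30; ring.
  by rewrite /cub b30; ring.
(* The remaining parameter: the equations become [a0 = 2 m], [a1 = - 3 m ^ 2] and [b3 = m ^ 3], and
   scaling by [1 / m] gives the stated form. *)
pose m := - 3%:R * b3 / a1.
have b3E : b3 = - m * a1 / 3%:R by rewrite /m; field; rewrite n3.
have a1E : a1 = - 3%:R * m ^+ 2.
  have n27 : 27%:R != 0 :> K by rewrite (natrX _ 3 3) expf_neq0.
  apply: (mulfI (expf_neq0 2 nza1)).
  apply: (lincomb (e := 3%:R * ((3%:R * b3) ^+ 2 - 3%:R * a1 * (- a1 ^+ 2 / 9%:R)))).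
    by rewrite s4 mulr0.
  by rewrite /m; field; rewrite n9 nza1.
have nzm : m != 0.
  by apply: contra_neq nza1 => m0; rewrite a1E m0 expr0n mulr0.
have a0E : a0 = 2%:R * m.
  apply: (mulfI (expf_neq0 2 nza1)).
  have -> : a1 ^+ 2 * a0 = - 6%:R * a1 * b3.
    by apply: (lincomb s3); field.
  by rewrite /m; field.
exists m => //; apply: conj2_ext (conj2_trans cj (conj2_scale _ _ _ _ _ _ _ _ (invr_neq0
  nzm))).
  by move=> u v; rewrite /cub b3E a1E a0E; field; rewrite n3 n9 nzm.
by move=> u v; rewrite /cub b3E a1E; field; rewrite nzm n3 oner_neq0.
Qed.
End NormalFormNotThree.
(** * Characteristic 3 *)

(** Serves [complete2_char3_scalar] over 3 elements: the polarisation map is singular, or it is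
    scalar and [b0] is nonzero. *)
Definition scalar_test3 :=
  alli 3 (fun a0 => alli 3 (fun a1 => alli 3 (fun a2 => alli 3 (fun a3 =>
  alli 3 (fun b0 => alli 3 (fun b1 => alli 3 (fun b2 =>
    (mulm 3 a2 b1 == mulm 3 a1 b2) ||
    [&& b1 == 0%N, a2 == 0%N, ((a1 + b2) %% 3 == 0)%N & b0 != 0%N] ||
    alli 3 (fun b3 => ~~ complete_test 3 a0 a1 a2 a3 b0 b1 b2 b3)))))))).

Lemma scalar_test3_true : scalar_test3.
Proof. by vm_compute. Qed.

(** Serves [complete2_char3_form] over 3 elements; [mulm 3 2 l] stands for [- l]. *)
Definition form_test3 :=
  alli 3 (fun l => (l == 0%N) || alli 3 (fun a3 => alli 3 (fun b3 =>
    (b3 == 0%N) && ((a3 + mulm 3 l l) %% 3 == 0)%N && (l == 1%N) ||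
    ~~ complete_test 3 0 (mulm 3 2 l) 0 a3 1 0 l b3))).

Lemma form_test3_true : form_test3.
Proof. by vm_compute. Qed.

Section CharThreeForms.
Variable K : finFieldType.
Hypothesis c3 : (3%:R : K) = 0.

Lemma char3_neq2 : (2%:R : K) != 0.
Proof.
apply/eqP => c2; have /eqP := oner_neq0 K; apply.
by apply: (lincomb (e := 3%:R - 2%:R)); [rewrite c3 c2 subrr | ring].
Qed.
Let n2 := char3_neq2.

Lemma char3_cube_surj (x : K) : exists y, x = y ^+ 3.
Proof.
have inj : injective (fun s : K => s ^+ 3).
  move=> s t /= e; apply/eqP; rewrite -subr_eq0.
  suff : (s - t) ^+ 3 == 0 by rewrite expf_eq0.
  apply/eqP; apply: (lincomb (e := s ^+ 3 - t ^+ 3 + 3%:R * (s * t ^+ 2 - s ^+ 2 * t))).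
    by rewrite e c3 subrr mul0r addr0.
  by ring.
by have [g _ gK] := injF_bij inj; exists (g x); rewrite gK.
Qed.

Lemma char3_card : #|K| = 3%N \/ (8 < #|K|)%N.
Proof.
have [m cK] := card_odd n2; have q0 := natr_card K; have q1 := finNzRing_gt1 K.
have [|hq] := ltnP 8 #|K|; [by right|left].
have : #|K| \in [:: 3; 5; 7]%N.
  by move: hq q1; rewrite cK; case: m {cK} => [|[|[|[|m]]]] //; rewrite ltnNge; lia.
rewrite !inE => /or3P[]/eqP e //; rewrite e in q0.
  by case/eqP: n2; apply: (lincomb (e := 5%:R - 3%:R)); [rewrite c3 q0 subrr | ring].
by case/eqP: (oner_neq0 K); apply: (lincomb (e := 7%:R - 2%:R * 3%:R));
  [rewrite c3 q0 mulr0 subrr | ring].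
Qed.

Section Complete3.
Variables A0 A1 A2 A3 B0 B1 B2 B3 : K.
Hypothesis cp : complete2 (cub A0 A1 A2 A3) (cub B0 B1 B2 B3).

(* In characteristic 3, [f(s + t) - f(s - t) = 2 (f(t) + det(t, s) L(s))] with
   [L] linear. *)
Lemma complete2_char3 (x y u v z : K) :
  cub A0 A1 A2 A3 x y + (x * v - y * u) * (A2 * v - A1 * u) + z ^+ 2 * x = 0 ->
  cub B0 B1 B2 B3 x y + (x * v - y * u) * (B2 * v - B1 * u) + z ^+ 2 * y = 0 ->
  x = 0 /\ y = 0.
Proof.
set P := (X in X = 0 -> _); set Q := (X in _ -> X = 0 -> _) => P0 Q0.
have [] := @complete2_scaled _ _ _ _ _ _ _ _ _ cp z (u + x) (v + y) (u - x) (v - y).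
- apply: (lincomb (e := 2%:R * P + 3%:R * (2%:R * (A0 * u ^+ 2 * x + A1 * u * v * x
  + A2 * u * v * y + A3 * v ^+ 2 * y)))).
    by rewrite P0 c3 mulr0 mul0r addr0.
  by rewrite /P /cub; ring.
- apply: (lincomb (e := 2%:R * Q + 3%:R * (2%:R * (B0 * u ^+ 2 * x + B1 * u * v * x
  + B2 * u * v * y + B3 * v ^+ 2 * y)))).
    by rewrite Q0 c3 mulr0 mul0r addr0.
  by rewrite /Q /cub; ring.
have h (s t : K) : s + t = s - t -> t = 0.
  move=> /addrI /eqP; rewrite -subr_eq0 opprK -mulr2n -mulr_natl mulf_eq0 (negPf n2) /=.
  exact/eqP.
by move=> /h-> /h->.
Qed.

(** In [complete2_char3] take [(x, y) = (1, 0)]: the second equation is solved for [u], and the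
    first becomes the conic [d v ^ 2 + B1 z ^ 2 = A1 B0 - A0 B1], on which a point with [v] nonzero
    is needed. *)
Lemma complete2_char3_conic : (8 < #|K|)%N ->
  A2 * B1 - A1 * B2 != 0 -> B1 != 0 -> A0 * B1 - A1 * B0 = 0.
Proof.
set d := _ - A1 * B2 => hq nzd nz1.
have [//|nzc] := eqVneq (A0 * B1 - A1 * B0) 0; exfalso.
have [v [z [nzv e]]] : exists v z, v != 0 /\ d * v ^+ 2 + B1 * z ^+ 2 = A1 * B0 - A0 * B1.
  have [v [z e]] := quadric_solvable (A1 * B0 - A0 * B1) n2 nzd nz1.
  have [v0|nzv] := eqVneq v 0; last by exists v, z.
  have nzz : z != 0.
    apply: contra_neq nzc => z0.
    by rewrite -[LHS]opprK opprB -e v0 z0 !expr0n !mulr0 addr0 oppr0.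
  (* The point found is [(0, z)]; the line of slope [x] through it meets the conic a second time,
     with nonzero [v] if [x (d + B1 x ^ 2)] is nonzero. *)
  have [x nzx] : exists x, x * (d + B1 * x ^+ 2) != 0.
    apply/existsP; rewrite -[X in is_true X]negbK negb_exists; apply/negP => /forallP h.
    case/eqP: nzd; apply: (coefs_vanish (s := [:: 0; d; 0; B1]) _ _ 1).
      by apply: leq_trans hq.
    move=> x; rewrite horner_Poly /=; have := h x; rewrite negbK => /eqP hx.
    by rewrite -[RHS]hx; ring.
  move: nzx; rewrite mulf_eq0 negb_or => /andP[nzx nzy].
  pose w := - 2%:R * B1 * z * x / (d + B1 * x ^+ 2).
  exists w, (z + x * w); split.
    by rewrite !mulf_neq0 ?invr_eq0 // oppr_eq0.
  by rewrite -e v0 /w; field.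
have [] := @complete2_char3 1 0 ((B0 / v + B2 * v) / B1) v z.
- rewrite /cub; apply: (mulfI nz1).
  apply: (lincomb (e := d * v ^+ 2 + B1 * z ^+ 2 - (A1 * B0 - A0 * B1))).
    by rewrite e subrr.
  by rewrite /d; field; rewrite nzv nz1.
- by rewrite /cub; field; rewrite nzv nz1.
by move/eqP; rewrite oner_eq0.
Qed.

(** Here [L] is [l] times the identity. For [t = (x, y)] and [s = - f(t) / (l d)], the hypothesis
    gives [det(t, s) = d], so [f(t) + det(t, s) L(s) = 0]. *)
Lemma complete2_char3_eigen l (x y d : K) : A1 = - l -> A2 = 0 -> B1 = 0 -> B2 = l ->
  l != 0 -> d != 0 ->
  y * cub A0 A1 A2 A3 x y - x * cub B0 B1 B2 B3 x y = l * d ^+ 2 -> x = 0 /\ y = 0.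
Proof.
move=> E1 E2 E3 E4 nzl nzd e.
pose u := - cub A0 A1 A2 A3 x y / (l * d); pose v := - cub B0 B1 B2 B3 x y / (l * d).
have ed : x * v - y * u = d.
  transitivity ((y * cub A0 A1 A2 A3 x y - x * cub B0 B1 B2 B3 x y) / (l * d)).
    by rewrite /u /v; field; rewrite nzd nzl.
  by rewrite e; field; rewrite nzd nzl.
have L1 : A2 * v - A1 * u = l * u by rewrite E1 E2; ring.
have L2 : B2 * v - B1 * u = l * v by rewrite E3 E4; ring.
apply: (@complete2_char3 x y u v 0); rewrite ed ?L1 ?L2 ?/u ?/v; field; by rewrite nzd nzl.
Qed.

End Complete3.

(** Here [L] takes values in the first axis, so the second equation of [complete2_char3] does not
    involve [(u, v)]. It holds for some [(a, 1)] if [B0] is nonzero, cubing being surjective, and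
    for [(1, 0)] otherwise; the first equation must then be unsolvable. *)
Lemma complete2_char3_half (A0 A1 A2 A3 B0 B3 : K) :
  complete2 (cub A0 A1 A2 A3) (cub B0 0 0 B3) -> A1 = 0 /\ A2 = 0.
Proof.
move=> cp; have [b0|nzb] := eqVneq B0 0; last first.
  have key a z : B0 * a ^+ 3 + B3 + z ^+ 2 = 0 -> A2 - A1 * a = 0.
    move=> e; apply/eqP; apply: contraT => nz; exfalso.
    (* The choice [u = a * v - 1] makes the determinant 1, leaving an equation linear in [v]. *)
    pose c := - (cub A0 A1 A2 A3 a 1 + z ^+ 2 * a); pose v := (c - A1) / (A2 - A1 * a).
    have [] := complete2_char3 cp (x := a) (y := 1) (u := a * v - 1) (v := v) (z := z).
    - by rewrite /v /c; field.
    - by rewrite /cub -[RHS]e; ring.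
    by move=> _ /eqP; rewrite oner_eq0.
  (* [z = 0] and [z = 1] give two distinct zeros of [A2 - A1 * a]. *)
  have [a aE] := char3_cube_surj (- B3 / B0).
  have [b bE] := char3_cube_surj ((- B3 - 1) / B0).
  have ka : A2 - A1 * a = 0 by apply: (key a 0); rewrite -aE; field.
  have kb : A2 - A1 * b = 0 by apply: (key b 1); rewrite -bE; field.
  have ab : b - a != 0.
    rewrite subr_eq0; apply/eqP => e; have := bE; rewrite e -aE => /divIf /= h.
    have /eqP := oner_neq0 K; apply; apply: (lincomb (e := - (- B3 - 1 - - B3))).
      by rewrite h // subrr oppr0.
    by ring.
  have A10 : A1 = 0.
    apply: (mulIf ab); apply: (lincomb (e := (A2 - A1 * a) - (A2 - A1 * b))).
      by rewrite ka kb subrr.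
    by ring.
  by split=> //; rewrite -ka A10 mul0r subr0.
have key u v z : A0 + v * (A2 * v - A1 * u) + z ^+ 2 != 0.
  apply/eqP => e; have [] := complete2_char3 cp (x := 1) (y := 0) (u := u) (v := v) (z := z).
  - by rewrite /cub -[RHS]e; ring.
  - by rewrite /cub b0; ring.
  by move/eqP; rewrite oner_eq0.
have A10 : A1 = 0.
  apply/eqP; apply: contraT => nz; case/eqP: (key ((A0 + A2) / A1) 1 0).
  by field.
split=> //; apply/eqP; apply: contraT => nz.
have [v [z e]] := quadric_solvable (- A0) n2 nz (oner_neq0 K).
case/eqP: (key 0 v z); apply: (lincomb (e := A2 * v ^+ 2 + 1 * z ^+ 2 - - A0)).
  by rewrite e subrr.
by ring.
Qed.

(** A singular [L] has rank at most one, and a change of basis moves its image into the first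
    axis. *)
Lemma complete2_char3_degenerate (A0 A1 A2 A3 B0 B1 B2 B3 : K) :
  complete2 (cub A0 A1 A2 A3) (cub B0 B1 B2 B3) -> A2 * B1 - A1 * B2 = 0 ->
  [/\ A1 = 0, A2 = 0, B1 = 0 & B2 = 0].
Proof.
move=> cp d0.
have [/andP[/eqP b1 /eqP b2]|nz] := boolP ((B1 == 0) && (B2 == 0)).
  by rewrite b1 b2 in cp; have [-> ->] := complete2_char3_half cp.
have [k [E1 E2]] : exists k, A1 = k * B1 /\ A2 = k * B2.
  move: nz; rewrite negb_and; have [b1|nz1 _] := eqVneq B1 0 => /=.
    move=> nz2; exists (A2 / B2); rewrite divfK // b1 mulr0; split=> //.
    move/eqP: d0; rewrite b1 mulr0 sub0r oppr_eq0 mulf_eq0 (negPf nz2) orbF => /eqP//.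
  exists (A1 / B1); rewrite divfK //; split=> //.
  apply: (mulIf nz1); apply: (lincomb d0); by field.
have cj := conj2_trans (conj2_shear_u k A0 A1 A2 A3 B0 B1 B2 B3) (conj2_swap _ _ _ _ _ _ _ _).
move: cj; rewrite E1 E2 c3.
have -> : k * B1 + 0 * A0 * k - k * (B1 + 0 * B0 * k) = 0 by ring.
have -> : k * B2 + 2%:R * (k * B1) * k + 0 * A0 * k ^+ 2 - k * (B2 + 2%:R * B1 * k
  + 0 * B0 * k ^+ 2) = 0 by ring.
rewrite E1 E2 in cp => cj; have [b2 b1] := complete2_char3_half (conj2_complete cp cj).
have z1 : B1 = 0 by rewrite -b1; ring.
have z2 : B2 = 0 by rewrite -b2 z1; ring.
by rewrite z1 z2 !mulr0.
Qed.

(** [PB.[r] = 0] says that [(1, r)] is an eigenvector of [L]; otherwise [complete2_char3_conic]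
    gives [PJ.[r] = 0]. The product vanishes by degree, and [PJ] is nonzero since its middle
    coefficient is minus the determinant of [L]. So every [(1, r)] is an eigenvector. *)
Lemma complete2_char3_scalar_large (A0 A1 A2 A3 B0 B1 B2 B3 : K) : (8 < #|K|)%N ->
  complete2 (cub A0 A1 A2 A3) (cub B0 B1 B2 B3) -> A2 * B1 - A1 * B2 != 0 ->
  [/\ B1 = 0, A2 = 0 & A1 = - B2].
Proof.
move=> hq cp nzd.
pose PB := Poly [:: B1; 2%:R * B2 - A1; - 2%:R * A2].
pose PJ := Poly [:: A0 * B1 - A1 * B0; 2%:R * (A0 * B2 - A2 * B0); A1 * B2 - A2 * B1;
  A3 * B1 - A1 * B3; 2%:R * (A3 * B2 - A2 * B3)].
have : PB * PJ = 0.
  apply: poly_vanish => [|r].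
    rewrite (leq_trans (size_polyMleq _ _)) //.
    have sB : (size PB <= 3)%N by exact: size_Poly.
    have sJ : (size PJ <= 5)%N by exact: size_Poly.
    by move: (size PB) (size PJ) sB sJ hq => x y; lia.
  have cj := conj2_shear_v r A0 A1 A2 A3 B0 B1 B2 B3.
  have := complete2_char3_conic (conj2_complete cp cj) hq; rewrite c3 => h.
  rewrite hornerM; apply/eqP; rewrite mulf_eq0; apply/orP.
  have [pb|npb] := eqVneq PB.[r] 0; [by left|right].
  apply/eqP; apply: etrans (h _ _); first by rewrite horner_Poly /=; ring.
    by apply: contra_neq nzd => <-; ring.
  by apply: contra_neq npb => <-; rewrite horner_Poly /=; ring.
move/eqP; rewrite mulf_eq0 => /orP[]/eqP P0.
  have /= h0 := congr1 (fun P : {poly K} => P`_0) P0.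
  have /= h1 := congr1 (fun P : {poly K} => P`_1) P0.
  have /= h2 := congr1 (fun P : {poly K} => P`_2) P0.
  move: h0 h1 h2; rewrite !coef_Poly !coef0 /= => h0 h1 /eqP.
  rewrite mulf_eq0 oppr_eq0 (negPf n2) /= => /eqP h2; split=> //.
  apply: (lincomb (e := 3%:R * B2 - (2%:R * B2 - A1))).
    by rewrite c3 h1 mul0r subrr.
  by ring.
have := congr1 (fun P : {poly K} => P`_2) P0; rewrite coef_Poly coef0 /= => h.
by case/eqP: nzd; rewrite -opprB h oppr0.
Qed.
End CharThreeForms.

(** * Normal form in characteristic 3 *)

Section NormalFormThree.
Variable K : finFieldType.
Hypothesis c3 : (3%:R : K) = 0.
Let n2 := char3_neq2 c3.

(** If [B0 = 0], then by [complete2_char3_eigen] at [(x, 1)] the cubic [C] takes no nonzero square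
    value, so [C / g] takes only square values, although its two leading coefficients are
    nonzero. *)
Lemma complete2_char3_no_eigenvector (A0 A1 A2 A3 B0 B1 B2 B3 : K) : (8 < #|K|)%N ->
  complete2 (cub A0 A1 A2 A3) (cub B0 B1 B2 B3) -> A2 * B1 - A1 * B2 != 0 ->
  B0 != 0.
Proof.
move=> hq cp nzd; have [b1 a2 a1] := complete2_char3_scalar_large c3 hq cp nzd.
have nzl : B2 != 0.
  by apply: contra_neq nzd => b2; rewrite a2 a1 b2 mul0r mulr0 subrr.
apply/eqP => b0; have nzA := complete2_coef0 cp b0.
pose C x := A0 / B2 * x ^+ 3 + 1 * x ^+ 2 + (- B3 / B2) * x + A3 / B2.
have Csq x s : C x = s ^+ 2 -> s = 0.
  move=> e; apply/eqP; apply: contraT => nzs; exfalso.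
  have [|_ /eqP] := complete2_char3_eigen c3 cp (x := x) (y := 1) a1 a2 b1 erefl nzl nzs;
    last by rewrite oner_eq0.
  rewrite -e /C /cub b0 b1 a2 a1.
  apply: (lincomb (e := - (3%:R * (B2 * x ^+ 2)))); first by rewrite c3 mul0r oppr0.
  by field.
have [g gP] := square_class K.
have [g0|nzg] := eqVneq g 0.
  have : A0 / B2 * 1 = 0.
    apply: (cubic_square_valued n2 c3 hq (c := - B3 / B2) (d := A3 / B2)) => x.
    have [y [e|e]] := gP (C x); first by exists y.
    by exists 0; rewrite [LHS]e g0 mul0r expr0n.
  by apply/eqP; rewrite mulr1 mulf_neq0 // invr_eq0.
have : A0 / B2 / g * (1 / g) = 0.
  apply: (cubic_square_valued n2 c3 hq (c := - B3 / B2 / g) (d := A3 / B2 / g)) => x.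
  have -> : A0 / B2 / g * x ^+ 3 + 1 / g * x ^+ 2 + - B3 / B2 / g * x + A3 / B2 / g = C x / g.
    by rewrite /C; field; rewrite nzg nzl.
  have [y [e|e]] := gP (C x).
    by exists 0; rewrite e (Csq _ _ e) expr0n mul0r.
  by exists y; rewrite e mulrC mulKf.
by apply/eqP; rewrite !mulf_neq0 ?invr_eq0 // oner_neq0.
Qed.

Lemma complete2_char3_scalar (A0 A1 A2 A3 B0 B1 B2 B3 : K) :
  complete2 (cub A0 A1 A2 A3) (cub B0 B1 B2 B3) -> A2 * B1 - A1 * B2 != 0 ->
  [/\ B1 = 0, A2 = 0, A1 = - B2 & B0 != 0].
Proof.
have [cK|hq] := char3_card c3; last first.
  move=> cp nzd; have [-> -> ->] := complete2_char3_scalar_large c3 hq cp nzd.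
  by split=> //; apply: complete2_char3_no_eigenvector hq cp nzd.
have p3 : prime 3 by []; have sj := natr_surj p3 cK.
have [a0 ga0 ->] := sj A0; have [a1 ga1 ->] := sj A1; have [a2 ga2 ->] := sj A2.
have [a3 ga3 ->] := sj A3; have [b0 gb0 ->] := sj B0; have [b1 gb1 ->] := sj B1.
have [b2 gb2 ->] := sj B2; have [b3 gb3 ->] := sj B3.
move=> /(complete_testP p3 cK) ct nzd.
have := scalar_test3_true.
move=> /alliP/(_ ga0)/alliP/(_ ga1)/alliP/(_ ga2)/alliP/(_ ga3)/alliP/(_ gb0)/alliP/(_
  gb1)/alliP/(_ gb2).
case/orP=> [/orP[/eqP e|]|/alliP/(_ gb3)]; last by rewrite ct.
  case/eqP: nzd; have := congr1 (fun n => n%:R : K) e.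
  by rewrite /mulm !(natr_modp cK) !natrM => ->; rewrite subrr.
case/and4P => /eqP-> /eqP-> /eqP e nb0; split=> //.
  apply/eqP; rewrite -subr_eq0 opprK -natrD -(natr_modp cK) e //.
apply: contra nb0 => /eqP h; apply/eqP; exact: (natr_inj p3 cK).
Qed.

(** Over more than 8 elements, [H] has no zero since no [(x, 1)] is mapped to a multiple of itself.
    By [complete2_char3_eigen] at [(x, 1)] and [(1, 0)], neither [- H / l] nor [- 1 / l] is a
    nonzero square, so their quotient [H] is a square; being square-valued forces
    [H = (x ^ 2 + l) ^ 2]. *)
Lemma complete2_char3_form (l A3 B3 : K) : l != 0 ->
  complete2 (cub 0 (- l) 0 A3) (cub 1 0 l B3) ->
  [/\ B3 = 0, A3 = - l ^+ 2 & forall u : K, u ^+ 2 + l != 0].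
Proof.
move=> nzl; have [cK|hq] := char3_card c3.
  have p3 : prime 3 by []; have sj := natr_surj p3 cK.
  have [a3 ga3 ->] := sj A3; have [b3 gb3 ->] := sj B3; move: nzl.
  have [m gl ->] := sj l => nzm.
  have -> : - m%:R = (mulm 3 2 m)%:R :> K.
    rewrite /mulm (natr_modp cK) natrM; apply: (lincomb (e := - (3%:R * m%:R))).
      by rewrite c3 mul0r oppr0.
    by ring.
  move=> /(complete_testP (a0 := 0) (a2 := 0) (b0 := 1) (b1 := 0) p3 cK) ct.
  have := form_test3_true; move=> /alliP/(_ gl); case/orP => [/eqP e|].
    by rewrite e eqxx in nzm.
  move=> /alliP/(_ ga3)/alliP/(_ gb3); rewrite ct orbF => /andP[/andP[/eqP-> /eqP e] /eqP e1].
  split=> //; first by apply/eqP; rewrite -subr_eq0 opprK expr2 -natrM -natrD -(natr_modp cK)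
    -modnDmr e.
  move=> u; have [i gi ->] := sj u; rewrite e1 -natrX -natrD.
  case: i gi => [|[|[|//]]] _ /=; rewrite ?oner_neq0 //.
  apply/eqP => h; case/eqP: n2; apply: (lincomb (e := 5%:R - 3%:R)); last by ring.
  by rewrite c3 subr0.
move=> cp.
have gE x : x ^+ 4 + - l * x ^+ 2 + B3 * x + - A3 != 0.
  have cj := conj2_trans (conj2_swap 0 (- l) 0 A3 1 0 l B3) (conj2_shear_v x _ _ _ _ _ _ _ _).
  have := complete2_char3_no_eigenvector hq (conj2_complete cp cj) => h.
  rewrite -oppr_eq0; apply: contraNneq (h _) => [e|].
    rewrite -[X in _ == X]e; apply/eqP.
    by apply: (lincomb (e := - (3%:R * (l * x ^+ 2)))); [rewrite c3 mul0r oppr0 | ring].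
  rewrite c3; apply: contra_neq nzl => e; apply/eqP; rewrite -sqrf_eq0 -e; apply/eqP.
  by ring.
have nzy : - l^-1 != 0 by rewrite oppr_eq0 invr_eq0.
have [b30 a3E] : B3 = 0 /\ - A3 = (- l) ^+ 2.
  apply: (quartic_nonzero_square_valued n2 c3 hq) => x.
  pose H := x ^+ 4 + - l * x ^+ 2 + B3 * x + - A3.
  have HE : (- H / l) / (- l^-1) = H by rewrite invrN invrK mulNr mulrNN divfK.
  have [[s sE]|[[s sE]|[s sE]]] := square_or (- H / l) nzy.
  - have nzs : s != 0.
      apply: contraTneq (gE x) => s0; rewrite negbK -/H -oppr_eq0.
      by rewrite -[- H](divfK nzl) sE s0 expr0n mul0r.
    have [|_ /eqP] := complete2_char3_eigen c3 cp (x := x) (y :=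
      1) erefl erefl erefl erefl nzl nzs;
      last by rewrite oner_eq0.
    rewrite -sE /cub /H; apply: (lincomb (e := - (3%:R * (l * x ^+ 2)))).
      by rewrite c3 mul0r oppr0.
    by field.
  - have nzs : s != 0.
      by apply: contra_neq nzy => s0; rewrite sE s0 expr0n.
    have [|/eqP] := complete2_char3_eigen c3 cp (x := 1) (y :=
      0) erefl erefl erefl erefl nzl nzs;
      last by rewrite oner_eq0.
    by rewrite -sE /cub; field.
  exists s; last by rewrite -sE HE.
  by apply: contraTneq (gE x) => s0; rewrite negbK -/H -HE sE s0 expr0n.
split=> //; first by rewrite -[LHS]opprK a3E sqrrN.
move=> u; apply: contraTneq (gE u) => e; rewrite negbK b30 a3E; apply/eqP.
apply: (lincomb (e := (u ^+ 2 + l) ^+ 2 - 3%:R * (l * u ^+ 2))).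
  by rewrite e c3 mul0r expr0n subrr.
by ring.
Qed.

Lemma complete2_char3_normal_form (A0 A1 A2 A3 B0 B1 B2 B3 : K) :
  complete2 (cub A0 A1 A2 A3) (cub B0 B1 B2 B3) ->
  [/\ A1 = 0, A2 = 0, B1 = 0 & B2 = 0] \/
  exists2 l : K, (forall u : K, u ^+ 2 + l != 0) &
    conj2 (cub A0 A1 A2 A3) (cub B0 B1 B2 B3)
     (fun u v => - l * v * (u ^+ 2 + l * v ^+ 2)) (fun u v => u * (u ^+ 2 + l * v ^+ 2)).
Proof.
move=> cp; have [d0|nzd] := eqVneq (A2 * B1 - A1 * B2) 0.
  by left; exact: (complete2_char3_degenerate c3 cp d0).
right; have [b1 a2 a1 nzb] := complete2_char3_scalar cp nzd.
have nzl : B2 != 0.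
  by apply: contra_neq nzd => b2; rewrite a2 a1 b2 mul0r mulr0 subrr.
have [C1 [C2 [C3 [D1 [D2 [D3 [cj _ jE]]]]]]] := conj2_image_basis A0 A1 A2 A3 B1 B2 B3 nzb.
have cp' := conj2_complete cp cj.
(* [- C1] is the Jacobian, equal to [B2 * B0]; so the new [L] is nonzero and again scalar. *)
have nzC : C1 != 0.
  rewrite -oppr_eq0 jE b1 a1 mulr0 sub0r mulNr opprK mulf_neq0 //.
have nzd' : C2 * D1 - C1 * D2 != 0.
  by apply: contra_neq nzC => /(complete2_char3_degenerate c3 cp')[].
have [e1 e2 e3 _] := complete2_char3_scalar cp' nzd'; subst D1 C2 C1.
have nzD : D2 != 0 by rewrite -oppr_eq0.
have [e3 e4 an] := complete2_char3_form nzD cp'; exists D2 => //.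
by apply: conj2_ext cj => u v; rewrite /cub ?e3 ?e4; ring.
Qed.

End NormalFormThree.
(** * The quadratic extension *)

Section FixedField.
Variables (F : finFieldType) (phi : {rmorphism F -> F}).

Definition fixed_mem : {pred F} := fun x => phi x == x.

Lemma fixed_divring_closed : divring_closed fixed_mem.
Proof.
split=> [|x y /eqP ex /eqP ey|x y /eqP ex /eqP ey]; apply/eqP.
- exact: rmorph1.
- by rewrite rmorphB ex ey.
- by rewrite rmorphM fmorphV ex ey.
Qed.
HB.instance Definition _ := GRing.isDivringClosed.Build F fixed_mem fixed_divring_closed.

(** A type of its own, so that the results over an arbitrary [finFieldType] apply to it. *)
Record fixed_field := FixedField { fixed_val :> F; _ : fixed_val \in fixed_mem }.
HB.instance Definition _ := [isSub for fixed_val].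
HB.instance Definition _ := [Finite of fixed_field by <:].
HB.instance Definition _ := [SubChoice_isSubIntegralDomain of fixed_field by <:].
HB.instance Definition _ := [SubIntegralDomain_isSubField of fixed_field by <:].
End FixedField.

Section QuadraticExtension.
Variables (F : finFieldType) (phi : {rmorphism F -> F}).
Hypothesis phiK : forall x, phi (phi x) = x.
Local Notation K := (fixed_field phi).
Implicit Types (u v : K) (x y e w : F).

Lemma phi_val u : phi (val u) = val u.
Proof. by case: u => x /= /eqP. Qed.

Lemma fixed_valP x : phi x = x -> exists u : K, x = val u.
Proof. by move/eqP => h; exists (FixedField h). Qed.

Definition det2 e1 e2 := e1 * phi e2 - e2 * phi e1.
(** Coordinates in the basis [e1], [e2], by Cramer's rule for the system formed by [x] and
    [phi x]. *)
Definition coordl e1 e2 x := (x * phi e2 - e2 * phi x) / det2 e1 e2.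
Definition coordr e1 e2 x := (e1 * phi x - x * phi e1) / det2 e1 e2.
Definition chbasis e1 e2 w1 w2 x := coordl e1 e2 x * w1 + coordr e1 e2 x * w2.

Lemma coord_sum e1 e2 x : det2 e1 e2 != 0 ->
  x = coordl e1 e2 x * e1 + coordr e1 e2 x * e2.
Proof. by rewrite /coordl /coordr /det2 => nz; field. Qed.

Lemma phi_det2 e1 e2 : phi (det2 e1 e2) = - det2 e1 e2.
Proof. by rewrite /det2 rmorphB !rmorphM !phiK; ring. Qed.

Lemma phi_coordl e1 e2 x : phi (coordl e1 e2 x) = coordl e1 e2 x.
Proof.
rewrite /coordl fmorph_div (phi_det2 e1 e2) invrN mulrN -mulNr rmorphB !rmorphM !phiK.
by congr (_ / _); ring.
Qed.

Lemma phi_coordr e1 e2 x : phi (coordr e1 e2 x) = coordr e1 e2 x.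
Proof.
rewrite /coordr fmorph_div (phi_det2 e1 e2) invrN mulrN -mulNr rmorphB !rmorphM !phiK.
by congr (_ / _); ring.
Qed.

Lemma coordlE e1 e2 x y : det2 e1 e2 != 0 -> phi x = x -> phi y = y ->
  coordl e1 e2 (x * e1 + y * e2) = x.
Proof.
move=> nz ex ey; rewrite /coordl rmorphD !rmorphM ex ey.
by move: nz; rewrite /det2 => nz; field.
Qed.

Lemma coordrE e1 e2 x y : det2 e1 e2 != 0 -> phi x = x -> phi y = y ->
  coordr e1 e2 (x * e1 + y * e2) = y.
Proof.
move=> nz ex ey; rewrite /coordr rmorphD !rmorphM ex ey.
by move: nz; rewrite /det2 => nz; field.
Qed.

Lemma chbasisE e1 e2 w1 w2 u v : det2 e1 e2 != 0 ->
  chbasis e1 e2 w1 w2 (val u * e1 + val v * e2) = val u * w1 + val v * w2.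
Proof. by move=> nz; rewrite /chbasis coordlE ?coordrE ?phi_val. Qed.

Lemma chbasisK e1 e2 w1 w2 : det2 e1 e2 != 0 -> det2 w1 w2 != 0 ->
  cancel (chbasis e1 e2 w1 w2) (chbasis w1 w2 e1 e2).
Proof.
move=> nze nzw x; rewrite {2}/chbasis /chbasis.
by rewrite coordlE ?coordrE ?phi_coordl ?phi_coordr // -coord_sum.
Qed.

Lemma chbasisD e1 e2 w1 w2 : {morph chbasis e1 e2 w1 w2 : x y / x + y}.
Proof. by move=> x y; rewrite /chbasis /coordl /coordr rmorphD; ring. Qed.

Lemma chbasisZ e1 e2 w1 w2 c x : phi c = c ->
  chbasis e1 e2 w1 w2 (c * x) = c * chbasis e1 e2 w1 w2 x.
Proof. by move=> h; rewrite /chbasis /coordl /coordr rmorphM h; ring. Qed.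

Lemma det2_1 x : phi x != x -> det2 1 x != 0.
Proof. by rewrite /det2 rmorph1 mul1r mulr1 subr_eq0. Qed.

Variable theta : F.
Hypothesis nfix : phi theta != theta.

Lemma decomp x : exists u v, x = val u + val v * theta.
Proof.
have [u uE] := fixed_valP (phi_coordl 1 theta x).
have [v vE] := fixed_valP (phi_coordr 1 theta x).
exists u, v; rewrite -uE -vE.
by have := coord_sum x (det2_1 nfix); rewrite mulr1.
Qed.

Lemma decomp_inj u v u' v' :
  val u + val v * theta = val u' + val v' * theta -> u = u' /\ v = v'.
Proof.
have nz := det2_1 nfix; move=> e.
have e' : val u * 1 + val v * theta = val u' * 1 + val v' * theta by rewrite !mulr1.
split; apply: val_inj.
  by have := congr1 (coordl 1 theta) e'; rewrite !coordlE ?phi_val.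
by have := congr1 (coordr 1 theta) e'; rewrite !coordrE ?phi_val.
Qed.

Lemma card_fixed_field : #|F| = (#|{: K}| ^ 2)%N.
Proof.
pose h (w : K * K) := val w.1 + val w.2 * theta.
have hb : bijective h.
  have nz := det2_1 nfix.
  exists (fun x => (insubd (0 : K) (coordl 1 theta x), insubd (0 : K) (coordr 1 theta x))).
    move=> [u v]; rewrite /h /= -[val u]mulr1 coordlE ?coordrE ?phi_val //.
    by rewrite !valKd.
  move=> x; rewrite /h /= !insubdK; try by apply/eqP; rewrite ?phi_coordl ?phi_coordr.
  by have := coord_sum x nz; rewrite mulr1.
by rewrite -mulnn -card_prod (bij_eq_card hb).
Qed.

Variables a b c d : F.
Definition fphi x := a * phi x ^+ 3 + b * phi x ^+ 2 * x + c * phi x * x ^+ 2 + d * x ^+ 3.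

(** The two middle coefficients are made explicit because [b] and [c] are recovered from them in
    characteristic 3. *)
Lemma fphi_cub : exists A0 A1 A2 A3 B0 B1 B2 B3 : K,
  [/\ forall u v, fphi (val u + val v * theta) =
        val (cub A0 A1 A2 A3 u v) + val (cub B0 B1 B2 B3 u v) * theta,
      val A1 + val B1 * theta = 3%:R * a * phi theta + b * (theta + 2%:R * phi theta)
        + c * (2%:R * theta + phi theta) + 3%:R * d * theta &
      val A2 + val B2 * theta = 3%:R * a * phi theta ^+ 2
        + b * (phi theta ^+ 2 + 2%:R * theta * phi theta)
        + c * (theta ^+ 2 + 2%:R * theta * phi theta) + 3%:R * d * theta ^+ 2].
Proof.
have [A0 [B0 e0]] := decomp (a + b + c + d).
have [A1 [B1 e1]] := decomp (3%:R * a * phi theta + b * (theta + 2%:R * phi theta)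
        + c * (2%:R * theta + phi theta) + 3%:R * d * theta).
have [A2 [B2 e2]] := decomp (3%:R * a * phi theta ^+ 2
        + b * (phi theta ^+ 2 + 2%:R * theta * phi theta)
        + c * (theta ^+ 2 + 2%:R * theta * phi theta) + 3%:R * d * theta ^+ 2).
have [A3 [B3 e3]] := decomp (fphi theta).
exists A0, A1, A2, A3, B0, B1, B2, B3; split=> // u v.
transitivity ((val A0 + val B0 * theta) * val u ^+ 3 + (val A1
  + val B1 * theta) * val u ^+ 2 * val v
  + (val A2 + val B2 * theta) * val u * val v ^+ 2 + (val A3 + val B3 * theta) * val v ^+ 3).
  rewrite -e0 -e1 -e2 -e3 /fphi rmorphD rmorphM !phi_val; ring.
by rewrite /cub !(rmorphD, rmorphM, rmorphXn); ring.
Qed.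

End QuadraticExtension.

(** * Complete mappings fall under one of the two cases *)

Section Forward.
Variables (F : finFieldType) (phi : {rmorphism F -> F}).
Hypothesis phiK : forall x, phi (phi x) = x.
Local Notation K := (fixed_field phi).
Variable theta : F.
Hypothesis nfix : phi theta != theta.
Variables a b c d : F.
Local Notation f := (fphi phi a b c d).

Definition phi_conj (gamma : F) : Prop :=
  exists rho rhoi : F -> F,
  [/\ cancel rho rhoi, cancel rhoi rho,
      (forall x y, rho (x + y) = rho x + rho y) /\
      (forall e x, phi e = e -> rho (e * x) = e * rho x) &
      forall x, f x = rhoi (gamma * phi (rho x) * rho x ^+ 2)].

Lemma val_eq0 (x : K) : (val x == 0) = (x == 0).
Proof. by rewrite -(inj_eq val_inj). Qed.

Lemma fixed_natr n : ((n%:R : F) == 0) = ((n%:R : K) == 0).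
Proof. by rewrite -val_eq0 rmorph_nat. Qed.

Section Coordinates.
Variables A B : K -> K -> K.
Hypothesis fE : forall u v : K,
  f (val u + val v * theta) = val (A u v) + val (B u v) * theta.

Lemma injective_complete2 :
  injective f -> injective (fun x => f x + x) -> complete2 A B.
Proof.
move=> i1 i2; split=> u v u' v' e1 e2; apply: (decomp_inj nfix).
  by apply: i1; rewrite !fE e1 e2.
apply: i2; cbv beta; rewrite !fE.
transitivity (val (A u v + u) + val (B u v + v) * theta).
  by rewrite !rmorphD; ring.
by rewrite e1 e2 !rmorphD; ring.
Qed.

(** The conjugating map sends the basis supplied by [conj2], read in the basis [1], [theta], to [1],
    [w]. *)
Lemma conj2_phi_conj a' b' gamma w : conj2 A B a' b' -> phi w != w ->
  (forall u v : K, gamma * phi (val u + val v * w) * (val u + val v * w) ^+ 2 =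
     val (a' u v) + val (b' u v) * w) ->
  phi_conj gamma.
Proof.
move=> [x1 [y1 [x2 [y2 [nz h]]]]] nw gE.
pose e1 := val x1 + val y1 * theta; pose e2 := val x2 + val y2 * theta.
have nze : det2 phi e1 e2 != 0.
  have -> : det2 phi e1 e2 = val (x1 * y2 - x2 * y1) * (phi theta - theta).
    by rewrite /det2 /e1 /e2 !(rmorphD, rmorphN, rmorphM, phi_val); ring.
  by rewrite mulf_neq0 ?val_eq0 // subr_eq0.
have nzw := det2_1 nw.
exists (chbasis phi e1 e2 1 w), (chbasis phi 1 w e1 e2); split.
- exact: chbasisK.
- exact: chbasisK.
- by split=> [x y|s x]; [exact: chbasisD | exact: chbasisZ].
move=> x; have [u uE] := fixed_valP (phi_coordl phiK e1 e2 x).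
have [v vE] := fixed_valP (phi_coordr phiK e1 e2 x).
rewrite (coord_sum x nze) uE vE chbasisE // mulr1 gE -[val (a' u v)]mulr1 chbasisE //.
have -> : val u * e1 + val v * e2 = val (u * x1 + v * x2) + val (u * y1 + v * y2) * theta.
  by rewrite !rmorphD !rmorphM /e1 /e2; ring.
have [h1 h2] := h u v; rewrite fE h1 h2 !rmorphD !rmorphM /e1 /e2; ring.
Qed.
End Coordinates.

Hypothesis i1 : injective f.
Hypothesis i2 : injective (fun x => f x + x).

Lemma forward_char3 : (3%:R : F) = 0 ->
  (b = 0 /\ c = 0) \/ exists gamma, [/\ gamma != 0,
    phi gamma ^+ 2 - gamma * phi gamma + gamma ^+ 2 = 0 & phi_conj gamma].
Proof.
move=> c3; have c3K : (3%:R : K) = 0 by apply/eqP; rewrite -fixed_natr c3.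
have [A0 [A1 [A2 [A3 [B0 [B1 [B2 [B3 [fE h1 h2]]]]]]]]] := fphi_cub phiK nfix a b c d.
have cp := injective_complete2 fE i1 i2.
have [[E1 E2 E3 E4]|[l an cj]] := complete2_char3_normal_form c3K cp; [left|right].
  (* Modulo 3 the vanishing coefficients are [(b - c) (theta - phi theta)] and, once [b = c],
     [b (theta - phi theta) ^ 2]. *)
  rewrite E1 E3 in h1; rewrite E2 E4 in h2.
  have nz : theta - phi theta != 0 by rewrite subr_eq0 eq_sym.
  have bc : b = c.
    apply: (mulIf nz); apply: (lincomb (e := (3%:R * a * phi theta + b * (theta
      + 2%:R * phi theta)
        + c * (2%:R * theta + phi theta) + 3%:R * d * theta) - 3%:R * (a * phi theta
          + b * phi theta + c * theta + d * theta))).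
      by rewrite -h1 c3 !rmorph0 !mul0r addr0 subr0.
    by ring.
  suff b0 : b = 0 by rewrite -bc b0.
  apply: (mulIf nz); apply: (mulIf nz).
  apply: (lincomb (e := (3%:R * a * phi theta ^+ 2
        + b * (phi theta ^+ 2 + 2%:R * theta * phi theta)
        + c * (theta ^+ 2 + 2%:R * theta * phi theta) + 3%:R * d * theta ^+ 2)
     - 3%:R * (a * phi theta ^+ 2 + d * theta ^+ 2 + 2%:R * b * theta * phi theta))).
    by rewrite -h2 c3 !rmorph0 !mul0r addr0 subr0.
  by rewrite -bc; ring.
have n2 : (2%:R : F) != 0 by apply: char3_neq2.
have n2K : (2%:R : K) != 0 by apply: char3_neq2.
(* Neither [t ^ 2] nor [- l] is a square in [K], so their quotient is some [r ^ 2]. Then [w = r t]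
   satisfies [w ^ 2 = - l] and [phi w = - w], and serves as [gamma]. *)
pose t := theta - phi theta.
have nzt : t != 0 by rewrite subr_eq0 eq_sym.
have pt : phi t = - t by rewrite /t rmorphB phiK opprB.
have [s sE] : exists s : K, t ^+ 2 = val s.
  by apply: fixed_valP; rewrite rmorphXn pt sqrrN.
have nzs : s != 0 by rewrite -val_eq0 -sE expf_neq0.
have [[r rE]|[[r rE]|[r rE]]] := square_or (- l) nzs.
- by have := an r; rewrite -rE addNr eqxx.
- have : (t - val r) * (t + val r) = 0.
    apply: (lincomb (e := t ^+ 2 - val r ^+ 2)); last by ring.
    by rewrite sE rE rmorphXn subrr.
  move/eqP; rewrite mulf_eq0 subr_eq0 addr_eq0 => /orP[]/eqP tE.
    have := pt; rewrite tE phi_val => /eqP; rewrite -subr_eq0 opprK -mulr2n -mulr_natl.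
    by rewrite -tE mulf_eq0 (negPf n2) (negPf nzt).
  have := pt; rewrite tE rmorphN phi_val => /eqP; rewrite -subr_eq0 opprK -mulr2n -mulr_natl.
  by rewrite -tE mulf_eq0 (negPf n2) (negPf nzt).
pose w := val r * t.
have pw : phi w = - w by rewrite /w rmorphM phi_val pt mulrN.
have ww : w ^+ 2 = - val l.
  by rewrite /w exprMn sE -rmorphXn -rE -rmorphM divfK // rmorphN.
have nzw : w != 0.
  rewrite -sqrf_eq0 ww oppr_eq0 val_eq0.
  by have := an 0; rewrite expr0n add0r.
have nw : phi w != w.
  by rewrite pw -subr_eq0 -opprD oppr_eq0 -mulr2n -mulr_natl mulf_neq0.
exists w; split=> //.
  rewrite pw; apply: (lincomb (e := 3%:R * w ^+ 2)); last by ring.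
  by rewrite c3 mul0r.
apply: (conj2_phi_conj fE cj nw) => u v.
rewrite rmorphD rmorphM !phi_val pw.
have -> : val (- l * v * (u ^+ 2 + l * v ^+ 2)) =
  - val l * val v * (val u ^+ 2 + val l * val v ^+ 2) by ring.
have -> : val (u * (u ^+ 2 + l * v ^+ 2)) =
  val u * (val u ^+ 2 + val l * val v ^+ 2) by ring.
have -> : val l = - w ^+ 2 by rewrite ww opprK.
by ring.
Qed.

Lemma forward_not3 (w : F) : (3%:R : F) != 0 -> w ^+ 2 + w + 1 = 0 -> #|{: K}| != 2%N ->
  exists gamma, [/\ gamma != 0,
    phi gamma ^+ 2 - gamma * phi gamma + gamma ^+ 2 = 0 & phi_conj gamma].
Proof.
move=> n3 w0 cK2; have n3K : (3%:R : K) != 0 by rewrite -fixed_natr.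
have [A0 [A1 [A2 [A3 [B0 [B1 [B2 [B3 [fE _ _]]]]]]]]] := fphi_cub phiK nfix a b c d.
have cp := injective_complete2 fE i1 i2.
have ci := complete2_cube_inj cp.
(* Cubing is injective on [K], so [w] lies outside [K] and [phi w] is the other primitive cube root
   of unity. *)
have nw : phi w != w.
  apply/eqP => /fixed_valP[u uE]; case/eqP: n3.
  have u1 : u = 1.
    apply: ci; apply: val_inj; rewrite expr1n.
    transitivity (val u ^+ 3); first by ring.
    rewrite -uE; transitivity (1 : F); last by rewrite rmorph1.
    apply: (lincomb (e := (w - 1) * (w ^+ 2 + w + 1))); last by ring.
    by rewrite w0 mulr0.
  apply: (lincomb (e := w ^+ 2 + w + 1)) => //.
  by rewrite uE u1 rmorph1; ring.
have pw : phi w = - 1 - w.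
  have : (phi w - w) * (phi w + w + 1) = 0.
    have h : phi w ^+ 2 + phi w + 1 = 0.
      by have := congr1 phi w0; rewrite !rmorphD rmorphXn rmorph1 rmorph0.
    apply: (lincomb (e := phi w ^+ 2 + phi w + 1 - (w ^+ 2 + w + 1))); last by ring.
    by rewrite h w0 subrr.
  move/eqP; rewrite mulf_eq0 subr_eq0 (negPf nw) /= => /eqP h.
  by apply: (lincomb h); ring.
(* With 3 elements the characteristic would be 3; with 4, every nonzero cube would be 1. *)
have hq : (4 < #|{: K}|)%N.
  rewrite ltnNge; apply/negP => le4; have q0 := natr_card K; have q1 := finNzRing_gt1 K.
  have : #|{: K}| \in [:: 3; 4]%N.
    move: le4 q1 cK2; rewrite !inE; move: #|{: K}| => n.
    by case: n => [|[|[|[|[|n]]]]].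
  rewrite !inE => /orP[]/eqP cK; first by rewrite cK in q0; rewrite q0 eqxx in n3K.
  have : (#|{: K}| <= 2)%N.
    rewrite cardE; apply: (uniq_leq_size (s2 := [:: 0; 1])) (enum_uniq _) _ => x _.
    rewrite !inE; have [//|nzx] := eqVneq x 0.
    apply/eqP; apply: ci; rewrite expr1n; apply: (mulfI nzx); rewrite mulr1 -exprS -cK.
    exact: expf_card.
  by rewrite cK.
have [m nzm cj] := complete2_normal_form n3K hq cp.
have h2w : 2%:R + w != 0.
  apply/eqP => h; case/eqP: n3; apply: (lincomb (e := w ^+ 2 + w + 1 - (w - 1) * (2%:R + w)));
    last by ring.
  by rewrite w0 h mulr0 subrr.
(* For [x = u + v w], [(2 + w) x = 2 u - v + (u + v) w] and [x * phi x = u ^ 2 - u v + v ^ 2], the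
   factors of the normal form. *)
exists (val m * (2%:R + w)); split.
- by rewrite mulf_neq0 // val_eq0.
- rewrite rmorphM phi_val rmorphD rmorph_nat pw.
  apply: (lincomb (e := 3%:R * val m ^+ 2 * (w ^+ 2 + w + 1))); last by ring.
  by rewrite w0 mulr0.
apply: (conj2_phi_conj fE cj nw) => u v.
rewrite rmorphD rmorphM !phi_val pw.
have -> : val (m * (2%:R * u - v) * (u ^+ 2 - u * v + v ^+ 2)) =
  val m * (2%:R * val u - val v) * (val u ^+ 2 - val u * val v + val v ^+ 2) by ring.
have -> : val (m * (u + v) * (u ^+ 2 - u * v + v ^+ 2)) =
  val m * (val u + val v) * (val u ^+ 2 - val u * val v + val v ^+ 2) by ring.
have ww : w ^+ 2 = - w - 1 by apply: (lincomb w0); ring.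
set U := val u; set V := val v; set M := val m.
have N : (U + V * (- 1 - w)) * (U + V * w) = U ^+ 2 - U * V + V ^+ 2.
  apply: (lincomb (e := - V ^+ 2 * (w ^+ 2 + w + 1))); last by ring.
  by rewrite w0 mulr0.
transitivity (M * ((2%:R + w) * (U + V * w)) * ((U + V * (- 1 - w)) * (U + V * w)));
  first by ring.
rewrite N.
have -> : (2%:R + w) * (U + V * w) = 2%:R * U - V + (U + V) * w.
  apply: (lincomb (e := V * (w ^+ 2 + w + 1))); last by ring.
  by rewrite w0 mulr0.
by ring.
Qed.

End Forward.

(** * Both cases give complete mappings *)

Section Backward.
Variables (F : finFieldType) (phi : {rmorphism F -> F}).
Hypothesis phiK : forall x, phi (phi x) = x.

Lemma norm_eq0 (x : F) : x * phi x = 0 -> x = 0.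
Proof. by move/eqP; rewrite mulf_eq0 fmorph_eq0 orbb => /eqP. Qed.

Section Twist.
Variable g : F.
Hypothesis nzg : g != 0.
Hypothesis gE : phi g ^+ 2 - g * phi g + g ^+ 2 = 0.

Lemma twist_not_fixed : g - phi g != 0.
Proof.
rewrite subr_eq0; apply/eqP => e; have /eqP := gE; rewrite -e -!expr2 subrr add0r.
by rewrite expf_eq0 (negPf nzg).
Qed.

(** Subtracting the conjugate equation leaves [(g - phi g) (n - m) = 0]. *)
Lemma twist_linear_form (n m e : F) : phi n = n -> phi m = m -> phi e = e ->
  g * n + phi g * m + e = 0 -> n = m.
Proof.
move=> en em ee h; have h' := congr1 phi h.
rewrite !rmorphD !rmorphM phiK en em ee rmorph0 in h'.
apply: (mulfI twist_not_fixed).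
apply: (lincomb (e := g * n + phi g * m + e - (phi g * n + g * m + e))); last by ring.
by rewrite h h' subrr.
Qed.

(** Norms give [n ^ 3 = m ^ 3]. By [gE], [g ^ 2 (n ^ 3 - m ^ 3)] splits into [n - m] and two linear
    factors; comparing either with its conjugate also leads to [n = m]. *)
Lemma twist_inj : injective (fun x => g * phi x * x ^+ 2).
Proof.
move=> x z /= h.
have [n nE] : exists n, n = x * phi x by eexists.
have [m mE] : exists m, m = z * phi z by eexists.
have pn : phi n = n by rewrite nE rmorphM phiK mulrC.
have pm : phi m = m by rewrite mE rmorphM phiK mulrC.
have hx : g * n * x = g * m * z by rewrite nE mE; apply: etrans (etrans h _); ring.
have hn : n ^+ 3 = m ^+ 3.
  have nzN : g * phi g != 0 by rewrite mulf_neq0 ?fmorph_eq0.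
  apply: (mulfI nzN).
  have -> : g * phi g * n ^+ 3 = (g * n * x) * phi (g * n * x).
    by rewrite !rmorphM pn nE; ring.
  by rewrite hx !rmorphM pm mE; ring.
have nm : n = m.
  have : (n - m) * ((g * n + phi g * m) * (g * n + (g - phi g) * m)) = 0.
    apply: (lincomb (e := g ^+ 2 * (n ^+ 3 - m ^+ 3) - (n - m) * m ^+ 2 * (phi g ^+ 2
      - g * phi g + g ^+ 2))); last by ring.
    by rewrite hn gE subrr !mulr0 subrr.
  move/eqP; rewrite !mulf_eq0 => /or3P[]/eqP e.
  - by apply/eqP; rewrite -subr_eq0 e.
  - by apply: (twist_linear_form (e := 0)); rewrite ?rmorph0 ?addr0.
  have e' := congr1 phi e; rewrite rmorphD !rmorphM rmorphB phiK pn pm rmorph0 in e'.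
  have n2m : n = - 2%:R * m.
    apply: (mulfI twist_not_fixed).
    apply: (lincomb (e := g * n + (g - phi g) * m - (phi g * n + (phi g - g) * m)));
      last by ring.
    by rewrite e e' subrr.
  have : 3%:R * m * (3%:R * m ^+ 2) = 0.
    apply: (lincomb (e := - (n ^+ 3 - m ^+ 3))); first by rewrite hn subrr oppr0.
    by rewrite n2m; ring.
  move/eqP; rewrite !mulf_eq0.
  have [c3 _|_ /=] := eqVneq (3%:R : F) 0.
    rewrite n2m; apply: (lincomb (e := - (3%:R * m))); last by ring.
    by rewrite c3 mul0r oppr0.
  by rewrite !orbb => /eqP m0; rewrite n2m m0 mulr0.
rewrite nm in hx; have [m0|nzm] := eqVneq m 0.
  have -> : z = 0 by apply: norm_eq0; rewrite -mE.
  by apply: norm_eq0; rewrite -nE nm.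
by apply: mulfI hx; rewrite mulf_neq0.
Qed.

Lemma twist_add_inj : injective (fun x => g * phi x * x ^+ 2 + x).
Proof.
move=> x z /= h.
have [n nE] : exists n, n = x * phi x by eexists.
have [m mE] : exists m, m = z * phi z by eexists.
have pn : phi n = n by rewrite nE rmorphM phiK mulrC.
have pm : phi m = m by rewrite mE rmorphM phiK mulrC.
have hx : (g * n + 1) * x = (g * m + 1) * z.
  by rewrite nE mE; apply: etrans (etrans h _); ring.
have hn : (g * n + 1) * (phi g * n + 1) * n = (g * m + 1) * (phi g * m + 1) * m.
  transitivity ((g * n + 1) * x * phi ((g * n + 1) * x)).
    by rewrite rmorphM rmorphD rmorphM rmorph1 pn nE; ring.
  by rewrite hx rmorphM rmorphD rmorphM rmorph1 pm mE; ring.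
have nm : n = m.
  have : (n - m) * ((g * n + phi g * m + 1) * (g * m + phi g * n + 1)) = 0.
    apply: (lincomb (e := (g * n + 1) * (phi g * n + 1) * n - (g * m + 1) * (phi g * m + 1) * m
       + (n - m) * n * m * (phi g ^+ 2 - g * phi g + g ^+ 2))); last by ring.
    by rewrite hn gE subrr mulr0 addr0.
  move/eqP; rewrite !mulf_eq0 => /or3P[]/eqP e.
  - by apply/eqP; rewrite -subr_eq0 e.
  - by apply: (twist_linear_form (e := 1)); rewrite ?rmorph1.
  - by symmetry; apply: (twist_linear_form (e := 1)); rewrite ?rmorph1.
(* If [g m + 1] were zero, comparison with its conjugate would give [m = 0], which is absurd. *)
rewrite nm in hx; apply: mulfI hx; apply/eqP => e.
have m0 : m = 0 by apply: (twist_linear_form (m := 0) (e := 1));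
  rewrite ?rmorph1 ?rmorph0 ?mulr0 ?addr0.
by move/eqP: e; rewrite m0 mulr0 add0r oner_eq0.
Qed.
End Twist.

(** In characteristic 3 the map is additive, so a trivial kernel suffices. *)
Lemma additive_cubic_inj (a d e : F) : (3%:R : F) = 0 ->
  (forall x, x != 0 -> a * phi x ^+ 3 + d * x ^+ 3 + e * x != 0) ->
  injective (fun x => a * phi x ^+ 3 + d * x ^+ 3 + e * x).
Proof.
move=> c3 h x y /= exy; apply/eqP; rewrite -subr_eq0; apply: contraT => /h/eqP[].
rewrite rmorphB.
apply: (lincomb (e := a * phi x ^+ 3 + d * x ^+ 3 + e * x - (a * phi y ^+ 3 + d * y ^+ 3
  + e * y)
  + 3%:R * (a * phi x * phi y * (phi y - phi x) + d * x * y * (y - x)))); last by ring.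
by rewrite exy c3 subrr mul0r addr0.
Qed.

Lemma norm_ker (a d x : F) : a * phi a != d * phi d -> x != 0 ->
  a * phi x ^+ 3 + d * x ^+ 3 != 0.
Proof.
move=> ad nzx; apply: contra_neq ad => e.
have e' := congr1 phi e; rewrite rmorphD !(rmorphXn, rmorphM) phiK rmorph0 in e'.
have nz : x ^+ 3 * phi x ^+ 3 != 0 by rewrite mulf_neq0 // expf_neq0 ?fmorph_eq0.
apply: (mulIf nz).
apply: (lincomb (e := (a * phi x ^+ 3 + d * x ^+ 3) * (phi a * x ^+ 3)
  - d * x ^+ 3 * (phi a * x ^+ 3 + phi d * phi x ^+ 3))); last by ring.
by rewrite e e' mul0r mulr0 subrr.
Qed.

(** Every value [y] satisfies [phi d * y = a * phi y]. If all [y] are values, [y = 1] gives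
    [phi d = a], and [phi] would be the identity unless [a = d = 0]. *)
Lemma norm_eq_not_surj (a d theta : F) : phi theta != theta -> a * phi a = d * phi d ->
  ~ (forall y, exists x, y = a * phi x ^+ 3 + d * x ^+ 3).
Proof.
move=> nfix ad sj.
have key y : phi d * y = a * phi y.
  have [x ->] := sj y; rewrite rmorphD !(rmorphXn, rmorphM) phiK.
  apply: (lincomb (e := - (a * phi a - d * phi d) * x ^+ 3)); last by ring.
  by rewrite ad subrr oppr0 mul0r.
have k1 := key 1; rewrite rmorph1 !mulr1 in k1.
have [a0|nza] := eqVneq a 0.
  have d0 : d = 0 by apply/eqP; rewrite -(fmorph_eq0 phi) k1 a0.
  have [x /eqP] := sj 1; by rewrite a0 d0 !mul0r addr0 oner_eq0.
case/eqP: nfix; apply: (mulfI nza); by rewrite -key k1.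
Qed.

End Backward.

(** In characteristic 2, [f x = x] means [f x + x = 0]. So [f] permutes the three nonzero elements
    without fixed point, hence as a 3-cycle, which is multiplication by [f 1]. *)
Lemma complete_F4 (F : finFieldType) (f : F -> F) : #|F| = 4%N -> f 0 = 0 ->
  injective f -> injective (fun x => f x + x) ->
  exists g : F, [/\ g != 0, g ^+ 2 - g + 1 = 0 & forall x, f x = g * x].
Proof.
move=> cF f0 i1 i2.
have c2 : (2%:R : F) = 0.
  by have /eqP := natr_card F; rewrite cF (natrX _ 2 2) sqrf_eq0 => /eqP.
have cube (x : F) : x != 0 -> x ^+ 3 = 1.
  by move=> nz; apply: (mulfI nz); rewrite mulr1 -exprS -cF expf_card.
have fn0 (x : F) : x != 0 -> f x != 0.
  by apply: contra_neq => e; apply: i1; rewrite e f0.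
have fnx (x : F) : x != 0 -> f x != x.
  apply: contra_neq => e; apply: i2; rewrite f0 addr0 e.
  by rewrite -mulr2n -mulr_natl c2 mul0r.
pose g := f 1; have nz1 := oner_neq0 F.
have nzg : g != 0 by apply: fn0.
have ng1 : g - 1 != 0 by rewrite subr_eq0 fnx.
have gE : g ^+ 2 + g + 1 = 0.
  apply: (mulfI ng1); rewrite mulr0; apply: (lincomb (e := g ^+ 3 - 1)); last by ring.
  by rewrite cube // subrr.
have three (x y : F) : x != 0 -> y != 0 -> [\/ y = x, y = g * x | y = g ^+ 2 * x].
  move=> nx ny; have : (y - x) * ((y - g * x) * (y - g ^+ 2 * x)) = 0.
    apply: (lincomb (e := y ^+ 3 - x ^+ 3 + x ^+ 3 - g ^+ 3 * x ^+ 3 + (g ^+ 2 + g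
      + 1) * (g * x ^+ 2 * y - x * y ^+ 2))); last by ring.
    by rewrite !cube // gE mul0r addr0 mulr1 subrr add0r subrr.
  move/eqP; rewrite !mulf_eq0 !subr_eq0 => /or3P[]/eqP; [exact: Or31|exact: Or32|exact: Or33].
have g3 := cube _ nzg.
have fg : f g = g ^+ 2.
  have [/eqP|//|e] := three g (f g) nzg (fn0 _ nzg); first by rewrite (negPf (fnx _ nzg)).
  have nzg2 : g ^+ 2 != 0 by rewrite expf_neq0.
  have e1 : f g = 1 by rewrite e -exprSr.
  have [/eqP|e2|e2] := three (g ^+ 2) (f (g ^+ 2)) nzg2 (fn0 _ nzg2);
    first by rewrite (negPf (fnx _ nzg2)).
    have /i1 h : f (g ^+ 2) = f g by rewrite e2 e1 -exprS.
    by case/eqP: ng1; apply: (mulfI nzg); rewrite mulrBr -expr2 h mulr1 mulr0 subrr.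
  have /i1 h : f (g ^+ 2) = f 1 by rewrite e2 -exprD -[(2 + 2)%N]/(3
    + 1)%N exprD g3 mul1r expr1.
  by case/eqP: ng1; move: g3; rewrite exprS h mulr1 => ->; rewrite subrr.
exists g; split=> //.
  by apply: (lincomb (e := g ^+ 2 + g + 1 - 2%:R * g)); [rewrite gE c2 mul0r subrr | ring].
move=> x; have [->|nzx] := eqVneq x 0; first by rewrite f0 mulr0.
have [->|->|->] := three 1 x nz1 nzx; rewrite ?mulr1 //.
have nzg2 : g ^+ 2 != 0 by rewrite expf_neq0.
have [/eqP|//|e2] := three (g ^+ 2) (f (g ^+ 2)) nzg2 (fn0 _ nzg2);
  first by rewrite (negPf (fnx _ nzg2)).
have /i1 h : f (g ^+ 2) = f 1 by rewrite e2 -exprD -[(2 + 2)%N]/(3 + 1)%N exprD g3 mul1r expr1.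
by case/eqP: ng1; move: g3; rewrite exprS h mulr1 => ->; rewrite subrr.
Qed.

(** * Frobenius, cube roots of unity and the final assembly *)

Lemma frobenius_rmorphism (p k : nat) (F : finFieldType) :
  p \in [pchar F] -> exists phi : {rmorphism F -> F}, forall x, phi x = x ^+ (p ^ k).
Proof.
move=> cp; have pn : [pchar F].-nat (p ^ k)%N.
  by rewrite pnatX (eq_pnat _ (pcharf_eq cp)) pnat_id // (pcharf_prime cp).
pose h (x : F) := x ^+ (p ^ k).
have hB : zmod_morphism h.
  move=> x y; apply/eqP; rewrite eq_sym subr_eq /h -exprDn_pchar //.
  by rewrite subrK.
have hM : monoid_morphism h by split=> [|x y]; rewrite /h ?expr1n ?exprMn.
pose phi : {rmorphism F -> F} := HB.pack h
  (GRing.isZmodMorphism.Build F F h hB) (GRing.isMonoidMorphism.Build F F h hM).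
by exists phi.
Qed.

(** With [#|F| - 1 = 3 n], some nonzero [x] has [x ^ n] different from 1, and its cube is 1. *)
Lemma exists_cube_root_unity (F : finFieldType) : (3 %| #|F|.-1)%N ->
  exists w : F, w ^+ 2 + w + 1 = 0.
Proof.
move=> /dvdnP[n nE]; have F1 := finNzRing_gt1 F.
have n0 : (0 < n)%N by case: n nE => //; move: F1; case: #|F| => [|[|]].
have [x nzx nx] : exists2 x : F, x != 0 & x ^+ n != 1.
  apply/exists_inP; apply: contraT; rewrite negb_exists_in => /forall_inP h.
  have : 'X * ('X^n - 1) = 0 :> {poly F}.
    apply: poly_vanish => [|x].
      rewrite (leq_trans (size_polyMleq _ _)) // size_polyX size_XnsubC //.
      by move: nE F1; move: #|F| => N; lia.
    rewrite hornerM hornerX hornerD hornerN hornerXn hornerC.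
    have [->|nzx] := eqVneq x 0; first by rewrite mul0r.
    by have := h _ nzx; rewrite negbK => /eqP->; rewrite subrr mulr0.
  move/eqP; rewrite mulf_eq0 polyX_eq0 -size_poly_eq0 size_XnsubC //.
exists (x ^+ n); have nz : x ^+ n - 1 != 0 by rewrite subr_eq0.
apply: (mulfI nz); rewrite mulr0.
apply: (lincomb (e := (x ^+ n) ^+ 3 - 1)); last by ring.
rewrite -exprM -nE; apply/eqP; rewrite subr_eq0; apply/eqP.
apply: (mulfI nzx); rewrite mulr1 -exprS prednK ?expf_card //.
exact: ltnW.
Qed.

Lemma fabcd_fphi (F : finFieldType) (q : nat) (phi : {rmorphism F -> F}) (a b c d x : F) :
  (forall x, phi x = x ^+ q) -> fabcd q a b c d x = fphi phi a b c d x.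
Proof.
move=> phiE; rewrite /fabcd /fphi phiE mulnC exprM mulnC exprD exprM expr1 exprD.
by rewrite -[(x ^+ q) ^+ 2]exprM mulnC exprM; ring.
Qed.

Lemma gamma_condition (F : finFieldType) (q : nat) (phi : {rmorphism F -> F}) (g : F) :
  (0 < q)%N -> (forall x, phi x = x ^+ q) -> g != 0 ->
  (g ^+ (2 * q - 2) - g ^+ (q - 1) + 1 = 0) <->
  (phi g ^+ 2 - g * phi g + g ^+ 2 = 0).
Proof.
move=> q0 phiE nzg.
have -> : phi g ^+ 2 - g * phi g + g ^+ 2 =
  g ^+ 2 * (g ^+ (2 * q - 2) - g ^+ (q - 1) + 1).
  have -> : (2 * q - 2 = (q - 1) + (q - 1))%N by lia.
  by rewrite phiE -{1 2}(subnK q0) !exprD expr1; ring.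
split=> [->|/eqP]; first by rewrite mulr0.
by rewrite mulf_eq0 expf_eq0 (negPf nzg) /= => /eqP.
Qed.

Theorem theorem1p1 (p k q : nat) (F : finFieldType)
  (hp : prime p) (hk : (0 < k)%N) (hq : q = (p ^ k)%N)
  (hF : #|F| = (q ^ 2)%N) (a b c d : F) :
  complete_mapping (fabcd q a b c d) <->
  ((exists gamma : F,
      [/\ gamma != 0,
          gamma ^+ (2 * q - 2) - gamma ^+ (q - 1) + 1 = 0 &
          Fq_lin_conj q (fabcd q a b c d) (fun x => gamma * x ^+ (q + 2))])
   \/
   [/\ (q %% 3 = 0)%N, b = 0, c = 0,
       a ^+ (q + 1) != d ^+ (q + 1) &
       forall x : F, x != 0 -> a * x ^+ (3 * q - 1) + d * x ^+ 2 + 1 != 0]).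
Proof.
have cF : #|F| = (p ^ (k * 2))%N by rewrite hF hq expnM.
have pF : p \in [pchar F] := card_finPcharP cF hp.
have [phi phiE'] := frobenius_rmorphism k pF.
have phiE x : phi x = x ^+ q by rewrite phiE' hq.
have q1 : (1 < q)%N by rewrite hq -(exp1n k) ltn_exp2r // prime_gt1.
have q0 : (0 < q)%N by apply: ltnW.
have phiK x : phi (phi x) = x by rewrite !phiE -exprM mulnn -hF expf_card.
have [theta nfix] : exists theta, phi theta != theta.
  apply/existsP; apply: contraT; rewrite negb_exists => /forallP h.
  have : 'X^q - 'X = 0 :> {poly F}.
    apply: poly_vanish => [|x].
      rewrite size_polyDl ?size_polyXn ?size_polyN ?size_polyX // hF -mulnn.
      by rewrite -[X in (X < _)%N]muln1 ltn_pmul2l.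
    rewrite hornerD hornerN hornerXn hornerX -phiE.
    by have := h x; rewrite negbK => /eqP->; rewrite subrr.
  by move/eqP; rewrite -size_poly_eq0 size_polyDl ?size_polyXn ?size_polyN ?size_polyX.
have fE x : fabcd q a b c d x = fphi phi a b c d x := fabcd_fphi a b c d x phiE.
have normE x : x ^+ (q + 1) = x * phi x by rewrite phiE addn1 exprS.
have q3 : (3 %| q)%N = ((3%:R : F) == 0).
  by rewrite -(dvdn_pcharf pF) hq Euclid_dvdX // hk andbT !dvdn_prime2 // eq_sym.
split.
- case=> /bij_inj i1 /bij_inj i2.
  have j1 : injective (fphi phi a b c d) by move=> x y e; apply: i1; rewrite !fE.
  have j2 : injective (fun x => fphi phi a b c d x + x).
    by move=> x y /= e; apply: i2; rewrite !fE.
  (* The normal forms do not cover [q = 2]; there [x ^ (q + 2) = x ^ 4 = x], and conjugation by the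
     identity suffices. *)
  have [q2|nq2] := eqVneq q 2.
    left; have f0 : fabcd q a b c d 0 = 0.
      by rewrite /fabcd q2 !expr0n !mulr0 !addr0.
    have cF4 : #|F| = 4%N by rewrite hF q2.
    have [g [nzg gE gx]] := complete_F4 cF4 f0 i1 i2.
    exists g; split; rewrite ?q2 //.
    exists id, id; split=> // x; rewrite -q2 gx q2 -[(2 + 2)%N]/4%N.
    by rewrite -cF4 expf_card.
  have lift : (exists gamma, [/\ gamma != 0,
      phi gamma ^+ 2 - gamma * phi gamma + gamma ^+ 2 = 0 & phi_conj phi a b c d gamma]) ->
    exists gamma : F,
      [/\ gamma != 0, gamma ^+ (2 * q - 2) - gamma ^+ (q - 1) + 1 = 0 &
          Fq_lin_conj q (fabcd q a b c d) (fun x => gamma * x ^+ (q + 2))].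
    case=> g [nzg gE [rho [rhoi [k1 k2 [rD rZ] fx]]]]; exists g; split=> //.
      by apply/(gamma_condition q0 phiE nzg).
    exists rho, rhoi; split=> //.
      by split=> // e x eE; apply: rZ; rewrite phiE.
    by move=> x; rewrite fE fx phiE exprD mulrA.
  have [c3|n3] := eqVneq (3%:R : F) 0.
    have [[b0 c0]|] := forward_char3 phiK nfix j1 j2 c3; last by left; apply: lift.
    right; subst b c; split=> //.
    + by apply/eqP; rewrite -[_ == _]/(3 %| q)%N q3 c3.
    + rewrite !normE; apply/eqP => ad; apply: (norm_eq_not_surj phiK nfix ad) => y.
      have [g _ gK] := injF_bij j1; exists (g y); rewrite -{1}[y]gK /fphi; ring.
    (* A root [x] would be a zero of [f + id], as 0 is. *)
    move=> x nzx; apply: contra_neq nzx => e; apply: j2.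
    rewrite /fphi rmorph0; apply: (lincomb (e := x * (a * x ^+ (3 * q - 1) + d * x ^+ 2 + 1))).
      by rewrite e mulr0.
    have -> : phi x ^+ 3 = x * x ^+ (3 * q - 1).
      by rewrite phiE -exprM -exprS; congr (_ ^+ _); lia.
    by ring.
  left; apply: lift.
  (* Since 3 does not divide [q], [q ^ 2] is 1 modulo 3. *)
  have [w wE] : exists w : F, w ^+ 2 + w + 1 = 0.
    apply: exists_cube_root_unity; rewrite hF.
    have : (q %% 3 != 0)%N by rewrite -[_ == _]/(3 %| q)%N q3.
    have := ltn_pmod q (isT : 0 < 3)%N; rewrite {3}(divn_eq q 3).
    move: (q %% 3)%N (q %/ 3)%N => [|[|[|//]]] m // _ _.
      by apply/dvdnP; exists (3 * m ^ 2 + 2 * m)%N; rewrite -mulnn; nia.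
    by apply/dvdnP; exists (3 * m ^ 2 + 4 * m + 1)%N; rewrite -mulnn; nia.
  apply: (forward_not3 phiK nfix j1 j2 n3 wE).
  have := card_fixed_field phiK nfix; rewrite hF => /eqP; rewrite eqn_exp2r // => /eqP <-.
  exact: nq2.
case=> [[g [nzg gE [rho [rhoi [k1 k2 [rD _] fx]]]]]|[q3m -> -> ad nr]].
  have {}gE := (gamma_condition q0 phiE nzg).1 gE.
  have gx x : g * x ^+ (q + 2) = g * phi x * x ^+ 2 by rewrite phiE exprD mulrA.
  split; apply: injF_bij => x y.
    rewrite !fx => /(can_inj k2); rewrite !gx => /(twist_inj phiK nzg gE).
    exact: (can_inj k1).
  cbv beta => /(congr1 rho); rewrite !fx !rD !k2 !gx => /(twist_add_inj phiK nzg gE).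
  exact: (can_inj k1).
have c3 : (3%:R : F) = 0 by apply/eqP; rewrite -q3 /dvdn q3m.
rewrite !normE in ad.
have h x : fabcd q a 0 0 d x = a * phi x ^+ 3 + d * x ^+ 3 + 0 * x.
  by rewrite (fabcd_fphi a 0 0 d x phiE) /fphi; ring.
split; apply: injF_bij => x y.
  rewrite !h; apply: (additive_cubic_inj c3) => z nzz.
  by rewrite mul0r addr0 (norm_ker phiK).
cbv beta; rewrite !h => e; apply: (additive_cubic_inj (a := a) (d := d) (e := 1) (phi :=
  phi) c3); last first.
  by move: e; rewrite !mul0r !addr0 !mul1r.
move=> z nzz; have -> : a * phi z ^+ 3 + d * z ^+ 3 + 1 * z =
    z * (a * z ^+ (3 * q - 1) + d * z ^+ 2 + 1).
  have -> : phi z ^+ 3 = z * z ^+ (3 * q - 1).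
    by rewrite phiE -exprM -exprS; congr (_ ^+ _); lia.
  by ring.
by rewrite mulf_neq0 // nr.
Qed.
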